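(* As $N\to\infty$, $$\frac1N\sum_{n=2}^{N}\log\frac{s(n)}{n}=-e^{-\gamma}\log\log N+O(\log\log\log N),$$ where $\gamma$ is Euler's constant.
   Context: For an integer $n>1$, $s(n)=\sum_{d\mid n,\ d<n}d=\sigma(n)-n$, where $\sigma(n)=\sum_{d\mid n}d$. *)

(* Defs.v *)
From Stdlib Require Import Reals List Arith.
From Coquelicot Require Import Coquelicot.
Open Scope R_scope.

Definition aliquot (n : nat) : nat :=
  list_sum (filter (fun d => Nat.eqb (n mod d) 0) (List.seq 1 (n - 1))).

Fixpoint harmonic (n : nat) : R :=
  match n with
  | O => 0
  | S m => harmonic m + / INR (S m)
  end.

Definition euler_gamma : R :=
  real (Lim_seq (fun n => harmonic n - ln (INR n))).

Fixpoint log_ratio_sum (N : nat) : R :=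
  match N with
  | O => 0
  | S O => 0
  | S m => log_ratio_sum m + ln (INR (aliquot (S m)) / INR (S m))
  end.

(* Main.v *)
Require Import Defs.
From Stdlib Require Import Reals.
From Coquelicot Require Import Coquelicot.
From Stdlib Require Import ZArith Lra Lia.
From HB Require Import structures.
From mathcomp Require ssreflect ssrfun ssrbool eqtype ssrnat seq div prime bigop path fintype.
From mathcomp Require zify_ssreflect.
Open Scope R_scope.

(** Let p(n) be the least prime factor of n.  Since n/p(n) is the largest proper divisor of n,
    log (s(n)/n) = - log p(n) + log (p(n) s(n)/n), where the last term is nonnegative and at most
    the sum of p(n)/e over the divisors e > p(n) of n; composite e satisfy e >= p(n)^2, prime e
    contribute at most the sum over q of pi(q)/q^2, so this term is bounded on average.
    It remains to average log p(n).  For a prime p <= z = N^(1/(k+2)), with k about 4 log log N,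
    a truncated Legendre sieve gives N/p prod_(q<p) (1 - 1/q) integers n <= N with p(n) = p, which
    is e^-gamma N / (p log p) (1 + O(1/log p)) by Mertens; summed against log p this yields
    e^-gamma N log log z + O(N), and log log z = log log N + O(log log log N).  For z < p <= sqrt N
    the bound O(N/(p log p)) for the number of such n contributes
    O(N (log log N - log log z)), and for p > sqrt N only n = p remains.
    The constant of Mertens' third theorem is identified by comparing, as s -> 0+, the transforms
    of - log (1 - 1/p), placed at log p, and of 1/k, placed at k: both are log (1/s) + o(1). *)

(** The error ln ln ln N is the price of the sieve. For a prime [p], the truncated expansion costs
    [p ^ k] from rounding and a tail of order [exp (3 ln ln N - k)] relative to N/p. Weighted by ln
    p and summed over p, the tail gains a factor ln N, so [k >= 4 ln ln N] makes it bounded; the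
    rounding terms, summed over p <= z, stay below N as soon as [z ^ (k + 2) <= N]. Hence ln z is
    about ln N / (4 ln ln N), and the primes above z, where only the order of magnitude of the count
    is known, weigh ln ln N - ln ln z, about ln ln ln N. The error O(1/ln p) in Mertens' product is
    harmless because the sum of 1/(p ln p) over primes is bounded. As for the constant, partial
    summation gives ln k + c + o(1) for the sum of - ln (1 - 1/p) over p <= e^k, with c unknown,
    while the harmonic numbers are ln k + gamma + o(1). Their difference tends to c - gamma, hence
    so does its transform as s -> 0+, by an Abelian argument; but the Euler product and zeta(1 + s)
    ~ 1/s send this transform to 0. *)

(* A module, so that MathComp's notations for [nat] do not reach the final statement. *)
Module AliquotMean.
Import ssreflect ssrfun ssrbool eqtype ssrnat seq div prime bigop path fintype.
Import zify_ssreflect.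
Set Implicit Arguments.
Unset Strict Implicit.
Unset Printing Implicit Defensive.

(** * Real sums and logarithms *)

Arguments INR : simpl never.

HB.instance Definition _ := Monoid.isComLaw.Build R 0 Rplus
  (fun x y z => esym (Rplus_assoc x y z)) Rplus_comm Rplus_0_l.
HB.instance Definition _ := Monoid.isComLaw.Build R 1 Rmult
  (fun x y z => esym (Rmult_assoc x y z)) Rmult_comm Rmult_1_l.
HB.instance Definition _ := Monoid.isMulLaw.Build R 0 Rmult Rmult_0_l Rmult_0_r.
HB.instance Definition _ := Monoid.isAddLaw.Build R Rmult Rplus
  (fun x y z => Rmult_plus_distr_r x y z) (fun x y z => Rmult_plus_distr_l x y z).

Notation "\sum_ ( i <- r | P ) F" := (\big[Rplus/0%R]_(i <- r | P%B) F%R) : R_scope.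
Notation "\sum_ ( i <- r ) F" := (\big[Rplus/0%R]_(i <- r) F%R) : R_scope.
Notation "\sum_ ( m <= i < n | P ) F" := (\big[Rplus/0%R]_(m <= i < n | P%B) F%R) : R_scope.
Notation "\sum_ ( m <= i < n ) F" := (\big[Rplus/0%R]_(m <= i < n) F%R) : R_scope.
Notation "\prod_ ( i <- r | P ) F" := (\big[Rmult/1%R]_(i <- r | P%B) F%R) : R_scope.
Notation "\prod_ ( i <- r ) F" := (\big[Rmult/1%R]_(i <- r) F%R) : R_scope.

Section RealSums.
Variable I : eqType.
Implicit Types (r : seq I) (P Q : pred I) (F G : I -> R).

Lemma Rsum_le r P F G : (forall i, i \in r -> P i -> F i <= G i) ->
  \sum_(i <- r | P i) F i <= \sum_(i <- r | P i) G i.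
Proof.
move=> h; rewrite big_seq_cond [X in _ <= X]big_seq_cond.
apply: (big_ind2 Rle); first lra.
  by move=> *; lra.
by move=> i /andP[]; exact: h.
Qed.

Lemma Rsum_ge0 r P F : (forall i, i \in r -> P i -> 0 <= F i) ->
  0 <= \sum_(i <- r | P i) F i.
Proof.
move=> h; rewrite big_seq_cond; apply: big_ind; first lra.
  by move=> *; lra.
by move=> i /andP[]; exact: h.
Qed.

Lemma Rsum_abs r P F : Rabs (\sum_(i <- r | P i) F i) <= \sum_(i <- r | P i) Rabs (F i).
Proof.
apply: (big_ind2 (fun x y => Rabs x <= y)); first by rewrite Rabs_R0; lra.
  by move=> x1 x2 y1 y2 h1 h2; move: (Rabs_triang x1 y1); lra.
by move=> *; lra.
Qed.

Lemma Rsum_opp r P F : \sum_(i <- r | P i) - F i = - \sum_(i <- r | P i) F i.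
Proof.
by apply: (big_ind2 (fun x y => x = - y)) => [|x1 x2 y1 y2 -> ->|//]; ring.
Qed.

Lemma Rsum_sub r P F G : \sum_(i <- r | P i) (F i - G i) =
  \sum_(i <- r | P i) F i - \sum_(i <- r | P i) G i.
Proof. by rewrite /Rminus -Rsum_opp -big_split. Qed.

Lemma Rsum_add r P F G : \sum_(i <- r | P i) (F i + G i) =
  \sum_(i <- r | P i) F i + \sum_(i <- r | P i) G i.
Proof. by rewrite -big_split. Qed.

Lemma Rsum_mull r P F c : \sum_(i <- r | P i) (c * F i) = c * \sum_(i <- r | P i) F i.
Proof. by rewrite big_distrr. Qed.

Lemma Rsum_mulr r P F c : \sum_(i <- r | P i) (F i * c) = (\sum_(i <- r | P i) F i) * c.
Proof. by rewrite big_distrl. Qed.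

Lemma Rsum_leP r P Q F : (forall i, i \in r -> P i -> Q i) ->
  (forall i, i \in r -> Q i -> 0 <= F i) ->
  \sum_(i <- r | P i) F i <= \sum_(i <- r | Q i) F i.
Proof.
move=> h1 h2; rewrite big_mkcond [X in _ <= X]big_mkcond /=.
apply: Rsum_le => i ir _.
case Pi: (P i); first by rewrite h1 //; lra.
by case Qi: (Q i); [exact: h2 | lra].
Qed.

Lemma Rsum_le1 r (P : pred I) F i : i \in r -> P i ->
  (forall j, j \in r -> P j -> 0 <= F j) -> F i <= \sum_(j <- r | P j) F j.
Proof.
move=> ir Pi h; elim: r ir h => // a r IH; rewrite in_cons => ir h.
have h0 : 0 <= \sum_(j <- r | P j) F j.
  by apply: Rsum_ge0 => j jr; apply: h; rewrite in_cons jr orbT.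
rewrite big_cons; case/orP: ir => [/eqP <-|ir].
  by rewrite Pi; lra.
have := IH ir (fun j jr => h j (mem_behead (s := a :: r) jr)).
case: ifP => // Pa; have := h a (mem_head _ _) Pa; lra.
Qed.

Lemma Rsum_const_le r P F c : 0 <= c -> (forall i, i \in r -> P i -> F i <= c) ->
  \sum_(i <- r | P i) F i <= INR (size r) * c.
Proof.
move=> c0 h; apply: (Rle_trans _ (\sum_(i <- r) c)).
  rewrite big_mkcond; apply: Rsum_le => i ir _; case: ifP => // Pi; exact: h.
elim: r {h} => [|a r IH]; first by rewrite big_nil INR_0; lra.
rewrite big_cons [size _]/= S_INR; lra.
Qed.

Lemma Rprod_ge0 r P F : (forall i, i \in r -> P i -> 0 <= F i) ->
  0 <= \prod_(i <- r | P i) F i.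
Proof.
move=> h; rewrite big_seq_cond; apply: big_ind; first lra.
  by move=> *; apply: Rmult_le_pos.
by move=> i /andP[]; exact: h.
Qed.

Lemma Rprod_exp r P F : \prod_(i <- r | P i) exp (F i) = exp (\sum_(i <- r | P i) F i).
Proof.
apply: (big_ind2 (fun x y => x = exp y)) => [|x1 x2 y1 y2 -> ->|//].
  by rewrite exp_0.
by rewrite exp_plus.
Qed.

End RealSums.

Lemma Rsum_eq (I : eqType) (r : seq I) (P Q : pred I) F G :
  {in r, P =1 Q} -> (forall i, i \in r -> P i -> F i = G i) ->
  \sum_(i <- r | P i) F i = \sum_(i <- r | Q i) G i.
Proof.
move=> h1 h2; rewrite big_seq_cond [RHS]big_seq_cond.
rewrite (eq_bigl (fun i => (i \in r) && Q i)); last first.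
  by move=> i; case: (boolP (i \in r)) => //= ir; rewrite h1.
by apply: eq_bigr => i /andP[ir Qi]; apply: h2 => //; rewrite h1.
Qed.

Lemma Rsum_at_most_one (r : seq nat) (Q : pred nat) c : uniq r -> 0 <= c ->
  (forall d e, d \in r -> e \in r -> Q d -> Q e -> d = e) -> \sum_(d <- r | Q d) c <= c.
Proof.
move=> ur c0 h; case: (boolP (has Q r)) => [/hasP [d dr Qd]|hQ]; last first.
  rewrite big1_seq // => i /andP[Qi ir]; exfalso; move/negP: hQ; apply.
  by apply/hasP; exists i.
rewrite big_mkcond (bigD1_seq d) //= Qd big1_seq; first lra.
move=> i /andP[id ir]; case: ifP => // Qi.
by move: id; rewrite (h i d) ?eqxx.
Qed.

Lemma mem_iota1 N i : (i \in index_iota 1 N.+1) = (0 < i <= N)%N.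
Proof. by rewrite mem_index_iota ltnS. Qed.

Lemma Rsum_extend m n N (P : pred nat) F : (n <= N)%N ->
  (forall i, (m <= i < N)%N -> P i -> 0 <= F i) ->
  \sum_(m <= i < n | P i) F i <= \sum_(m <= i < N | P i) F i.
Proof.
move=> nN h; case: (leqP m n) => mn.
  rewrite (big_cat_nat mn nN) /=.
  have : 0 <= \sum_(n <= i < N | P i) F i.
    apply: Rsum_ge0 => i; rewrite mem_index_iota => /andP[a b] Pi; apply: h => //.
    by rewrite b (leq_trans mn a).
  lra.
rewrite big_geq; last exact: ltnW.
by apply: Rsum_ge0 => i; rewrite mem_index_iota; exact: h.
Qed.

Lemma Rsum_count (n : nat) c : \sum_(1 <= i < n.+1) c = INR n * c.
Proof.
elim: n => [|n IH]; first by rewrite big_geq // INR_0; lra.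
by rewrite big_nat_recr //= IH S_INR; lra.
Qed.

(** * Casts of natural numbers and elementary bounds for the logarithm *)

Lemma INR_2 : INR 2 = 2.
Proof. by []. Qed.

Lemma INR_pos n : (0 < n)%N -> 0 < INR n.
Proof. by move=> /ltP; exact: lt_0_INR. Qed.

Lemma INR_ge1 n : (0 < n)%N -> 1 <= INR n.
Proof. by move=> h; rewrite -INR_1; apply: le_INR; lia. Qed.

Lemma INR_leq m n : (m <= n)%N -> INR m <= INR n.
Proof. by move=> /leP; exact: le_INR. Qed.

Lemma INR_ltn m n : (m < n)%N -> INR m < INR n.
Proof. by move=> /ltP; exact: lt_INR. Qed.

Lemma mulnINR m n : INR (m * n)%N = INR m * INR n.
Proof. exact: mult_INR. Qed.

Lemma INR_divn n d : (0 < d)%N ->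
  INR (n %/ d) <= INR n / INR d /\ INR n / INR d < INR (n %/ d) + 1.
Proof.
move=> d0; have dp := INR_pos d0.
have e : INR n = INR (n %/ d) * INR d + INR (n %% d).
  by rewrite -mulnINR -plus_INR; congr INR; exact: divn_eq.
have m0 := pos_INR (n %% d).
have m1 : INR (n %% d) < INR d by apply: INR_ltn; rewrite ltn_mod.
split.
  apply: (Rmult_le_reg_r (INR d)) => //; field_simplify; lra.
apply: (Rmult_lt_reg_r (INR d)) => //; field_simplify; lra.
Qed.

Lemma exp_le x y : x <= y -> exp x <= exp y.
Proof. by case=> h; [apply: Rlt_le; exact: exp_increasing | rewrite h; lra]. Qed.

Lemma ln_nonpos x : x <= 0 -> ln x = 0.
Proof. by rewrite /ln; case: Rlt_dec => // h1 h2; exfalso; lra. Qed.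

Lemma ln_ge0 x : 1 <= x -> 0 <= ln x.
Proof. by move=> h; rewrite -ln_1; apply: ln_le; lra. Qed.

Lemma ln_le_sub1 x : 0 < x -> ln x <= x - 1.
Proof.
move=> x0; have := exp_ineq1_le (ln x); rewrite exp_ln //; lra.
Qed.

Lemma ln_ge_sub_inv x : 0 < x -> 1 - / x <= ln x.
Proof.
move=> x0; have h := ln_le_sub1 (Rinv_0_lt_compat _ x0).
rewrite ln_Rinv // in h; lra.
Qed.

Lemma ln_div x y : 0 < x -> 0 < y -> ln (x / y) = ln x - ln y.
Proof. by move=> x0 y0; rewrite /Rdiv ln_mult ?ln_Rinv //; exact: Rinv_0_lt_compat. Qed.

Lemma ln_INR_gt0 n : (1 < n)%N -> 0 < ln (INR n).
Proof. by move=> h; rewrite -ln_1; apply: ln_increasing; [lra | rewrite -INR_1; apply: INR_ltn]. Qed.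

Lemma ln_INR_ge0 n : 0 <= ln (INR n).
Proof.
case: n => [|n]; last by apply: ln_ge0; apply: INR_ge1.
rewrite INR_0 /ln; case: Rlt_dec => h; [by case: (Rlt_irrefl 0) | exact: Rle_refl].
Qed.

Lemma ln_succ_le m : (0 < m)%N -> ln (INR m.+1) - ln (INR m) <= / INR m.
Proof.
move=> m0; have mp := INR_pos m0; have := @ln_le_sub1 (INR m.+1 / INR m).
rewrite ln_div //; last by apply: INR_pos.
move=> h; apply: (Rle_trans _ _ _ (h _)).
  by apply: Rdiv_lt_0_compat => //; apply: INR_pos.
right; rewrite S_INR; field; lra.
Qed.

Lemma ln_succ_ge m : (0 < m)%N -> / INR m.+1 <= ln (INR m.+1) - ln (INR m).
Proof.
move=> m0; have mp := INR_pos m0; have := @ln_ge_sub_inv (INR m.+1 / INR m).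
rewrite ln_div //; last by apply: INR_pos.
move=> h; apply: (Rle_trans _ _ _ _ (h _)).
  right; rewrite S_INR; field; lra.
by apply: Rdiv_lt_0_compat => //; apply: INR_pos.
Qed.

(** * The von Mangoldt function *)

Lemma Rsum_multiples d n (P : pred nat) F : (0 < d)%N ->
  \sum_(1 <= i < n.+1 | (d %| i) && P i) F i =
  \sum_(1 <= m < (n %/ d).+1 | P (d * m)%N) F (d * m)%N.
Proof.
move=> d0; elim: n => [|n IH]; first by rewrite div0n !big_geq.
rewrite big_mkcond big_nat_recr //= -big_mkcond /= IH divnS //.
case: (boolP (d %| n.+1)) => h /=; last by rewrite add0n; lra.
rewrite add1n [RHS]big_mkcond [RHS]big_nat_recr //= -big_mkcond /=.
have e : (d * (n %/ d).+1 = n.+1)%N.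
  by rewrite -[in RHS](divnK h) divnS // h add1n mulnC.
by rewrite e.
Qed.

Lemma Rsum_count_multiples d n c : (0 < d)%N ->
  \sum_(1 <= i < n.+1 | d %| i) c = INR (n %/ d) * c.
Proof.
move=> d0; rewrite -Rsum_count -(Rsum_multiples n xpredT (fun=> c) d0).
by apply: eq_bigl => i; rewrite andbT.
Qed.

Lemma Rsum_divisors_swap n (P : pred nat) F :
  \sum_(1 <= i < n.+1 | P i) \sum_(1 <= d < i.+1 | d %| i) F i d =
  \sum_(1 <= d < n.+1) \sum_(1 <= m < (n %/ d).+1 | P (d * m)%N) F (d * m)%N d.
Proof.
transitivity (\sum_(1 <= i < n.+1 | P i) \sum_(1 <= d < n.+1 | d %| i) F i d).
  apply: Rsum_eq => // i; rewrite mem_iota1 => /andP[i0 iN] _.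
  rewrite [RHS](big_cat_nat (n := i.+1)) //= [X in _ + X]big1_seq ?Rplus_0_r //.
  move=> d /andP[di]; rewrite mem_index_iota => /andP[h _].
  by have := dvdn_leq i0 di; rewrite leqNgt h.
rewrite (exchange_big_dep xpredT) //=; apply: Rsum_eq => // d; rewrite mem_iota1 => /andP[d0 dn] _.
rewrite -(Rsum_multiples n P (fun i => F i d) d0).
by apply: eq_bigl => i; rewrite andbC.
Qed.

(** [primes n] lists the distinct prime factors, so a one-element list singles out the prime powers
    without naming an exponent. *)
Definition mangoldt n : R := if primes n is [:: p] then ln (INR p) else 0.

Lemma mangoldt_ge0 n : 0 <= mangoldt n.
Proof. rewrite /mangoldt; case: primes => [|p [|q l]]; try lra; exact: ln_INR_ge0. Qed.

Lemma mangoldt_neq0 d : mangoldt d <> 0 ->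
  exists p k, [/\ prime p, d = (p ^ k.+1)%N & mangoldt d = ln (INR p)].
Proof.
rewrite /mangoldt; case E: (primes d) => [|p [|q l]] // _.
have : p \in primes d by rewrite E mem_seq1.
rewrite mem_primes => /and3P[pp d0 pd].
have : p.-nat d by rewrite /pnat d0 E /= inE eqxx.
move=> /p_natP[k dk]; exists p; case: k dk => [|k] dk.
  by move: pd; rewrite dk expn0 dvdn1 => /eqP p1; move: pp; rewrite p1.
by exists k.
Qed.

Lemma mangoldt_primepow p k : prime p -> mangoldt (p ^ k.+1) = ln (INR p).
Proof. by move=> pp; rewrite /mangoldt primesX // primes_prime. Qed.

(** Induction by removing the least prime factor, n = p m: among the divisors of n that do not
    divide m, the only prime power is p ^ (v + 1), where v is the exponent of p in m, and it carries
    the missing ln p. *)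
Lemma ln_mangoldt n : (0 < n)%N -> ln (INR n) = \sum_(1 <= d < n.+1 | d %| n) mangoldt d.
Proof.
elim/ltn_ind: n => n IH n0.
case: (ltngtP n 1) => [|n1|->]; first by lia.
  set p := pdiv n; have pp : prime p by exact: pdiv_prime.
  have pn : p %| n by exact: pdiv_dvd.
  set m := (n %/ p)%N; have nE : n = (p * m)%N by rewrite mulnC divnK.
  have p1 := prime_gt1 pp.
  have m0 : (0 < m)%N by rewrite lt0n; apply/eqP => h; move: n0; rewrite nE h muln0.
  have mn : (m < n)%N by rewrite nE; apply: ltn_Pmull.
  rewrite {1}nE mulnINR ln_mult; [|by apply: INR_pos; lia|exact: INR_pos].
  rewrite (IH m) //; set e := (p ^ (logn p m).+1)%N.
  have en : e %| n by rewrite /e nE expnS dvdn_mul // pfactor_dvdnn.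
  have enm : ~~ (e %| m) by rewrite /e pfactor_dvdn // -ltnNge.
  have eN : (e <= n)%N by exact: dvdn_leq.
  have e0 : (0 < e)%N by rewrite expn_gt0 prime_gt0.
  rewrite [RHS](bigID (fun d => d %| m)) /= Rplus_comm; congr (_ + _).
    rewrite [RHS](big_cat_nat (n := m.+1)) //=; last exact: ltnW.
    rewrite [X in _ + X]big1_seq; last first.
      move=> d /andP[/andP[_ dm]]; rewrite mem_index_iota => /andP[h _].
      by have := dvdn_leq m0 dm; rewrite leqNgt h.
    rewrite Rplus_0_r; apply: eq_bigl => d; case: (boolP (d %| m)) => dm; last by rewrite andbF.
    by rewrite nE dvdn_mull.
  rewrite big_mkcond (bigD1_seq e) ?iota_uniq ?mem_iota1 ?e0 //= en enm /=.
  rewrite [X in _ + X]big1_seq; first by rewrite /e mangoldt_primepow // Rplus_0_r.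
  move=> d /andP[de _]; case: ifP => // /andP[dn dm].
  case: (Req_dec (mangoldt d) 0) => // h; exfalso.
  have [q [k [qp dE _]]] := mangoldt_neq0 h.
  have qpE : q = p.
    apply/eqP; apply/negPn/negP => qnp; move/negP: dm; apply.
    rewrite nE Gauss_dvdr // in dn; rewrite dE coprimeXl // prime_coprime //.
    by rewrite dvdn_prime2.
  move: dn dm de; rewrite dE qpE nE !pfactor_dvdn ?muln_gt0 ?m0 ?prime_gt0 //.
  rewrite (lognM p (prime_gt0 pp) m0) (logn_prime p pp) eqxx add1n ltnS -ltnNge ltnS => h1 h2.
  by rewrite /e (_ : k = logn p m) ?eqxx //; apply/eqP; rewrite eqn_leq h1.
rewrite big_mkcond big_nat1 /= ln_1 /mangoldt /=; lra.
Qed.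

(** * Chebyshev's bound and Mertens' first theorem *)

Definition lnfact n := \sum_(1 <= i < n.+1) ln (INR i).
Definition psi n := \sum_(1 <= d < n.+1) mangoldt d.

Lemma lnfactS n : lnfact n.+1 = lnfact n + ln (INR n.+1).
Proof. by rewrite /lnfact big_nat_recr. Qed.

Lemma lnfact0 : lnfact 0 = 0.
Proof. by rewrite /lnfact big_geq. Qed.

Lemma lnfact_mangoldt n :
  lnfact n = \sum_(1 <= d < n.+1) mangoldt d * INR (n %/ d).
Proof.
rewrite /lnfact (@Rsum_eq _ _ _ xpredT _
  (fun i => \sum_(1 <= d < i.+1 | d %| i) mangoldt d)) //; last first.
  by move=> i; rewrite mem_iota1 => /andP[i0 _] _; exact: ln_mangoldt.
rewrite (Rsum_divisors_swap n xpredT (fun i d => mangoldt d)).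
by apply: eq_bigr => d _; rewrite Rsum_count Rmult_comm.
Qed.

Lemma lnfact_le n : lnfact n <= INR n * ln (INR n).
Proof.
elim: n => [|n IH]; first by rewrite lnfact0 INR_0; lra.
rewrite lnfactS; case: n IH => [|n] IH; first by rewrite lnfact0 INR_1 ln_1; lra.
have h : ln (INR n.+1) <= ln (INR n.+2).
  by apply: ln_le; [exact: INR_pos | apply: INR_leq].
have := Rmult_le_compat_l _ _ _ (pos_INR n.+1) h.
have : INR n.+2 = INR n.+1 + 1 by exact: S_INR.
move: IH; set a := INR n.+1; set b := INR n.+2; set u := ln a; set v := ln b.
by move=> h1 h2 h3; have -> : b * v = a * v + v; [rewrite h2; ring | lra].
Qed.

Lemma lnfact_ge n : INR n * ln (INR n) - INR n <= lnfact n.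
Proof.
elim: n => [|n IH]; first by rewrite lnfact0 INR_0; lra.
rewrite lnfactS; case: n IH => [|n] IH; first by rewrite lnfact0 INR_1 ln_1; lra.
have h := ln_succ_le (ltn0Sn n); have np := INR_pos (ltn0Sn n).
have : INR n.+1 * (ln (INR n.+2) - ln (INR n.+1)) <= 1.
  by rewrite -(Rinv_r (INR n.+1)); [apply: Rmult_le_compat_l; lra | lra].
have : INR n.+2 = INR n.+1 + 1 by exact: S_INR.
move: IH; set a := INR n.+1; set b := INR n.+2; set u := ln a; set v := ln b.
move=> h1 h2 h3; have : b * v = a * v + v by rewrite h2; ring.
lra.
Qed.

(** The left side is the logarithm of the central binomial coefficient. Passing from m to m + 1 adds
    two logarithms, each exceeding ln (m + 1) by at most ln 2 <= 1. *)
Lemma lnfact_double m : lnfact (2 * m) - 2 * lnfact m <= 2 * INR m.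
Proof.
elim: m => [|m IH]; first by rewrite muln0 lnfact0 INR_0; lra.
rewrite mulnS add2n !lnfactS.
have h1 : ln (INR (2 * m).+2) <= ln 2 + ln (INR m.+1).
  rewrite -ln_mult; [|lra|exact: INR_pos].
  apply: ln_le; first exact: INR_pos.
  rewrite -[2]/(INR 2) -mulnINR; apply: INR_leq; lia.
have h2 : ln (INR (2 * m).+1) <= ln 2 + ln (INR m.+1).
  apply: Rle_trans h1; apply: ln_le; first exact: INR_pos.
  by apply: INR_leq.
have h3 : ln 2 <= 2 - 1 by apply: ln_le_sub1; lra.
have := S_INR m; lra.
Qed.

Lemma lnfact_half n : lnfact n - 2 * lnfact (n %/ 2) <= 2 * INR n.
Proof.
set m := (n %/ 2)%N; have hm := lnfact_double m.
have m0 := pos_INR m.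
have : n = (2 * m)%N \/ n = (2 * m).+1 by lia.
case=> nE.
  by rewrite {1}nE; apply: (Rle_trans _ _ _ hm); rewrite nE mulnINR INR_2; lra.
rewrite {1}nE lnfactS.
have : ln (INR (2 * m).+1) <= 2 * INR m.
  apply: (Rle_trans _ _ _ (ln_le_sub1 _)); first exact: INR_pos.
  by rewrite S_INR mulnINR INR_2; lra.
by rewrite nE S_INR mulnINR INR_2; lra.
Qed.

(** Chebyshev's argument: in the von Mangoldt expansion of the right side, the coefficient of
    [mangoldt d] is nonnegative for d <= n/2 and at least 1 for n/2 < d <= n. *)
Lemma psi_half n : psi n - psi (n %/ 2) <= lnfact n - 2 * lnfact (n %/ 2).
Proof.
set m := (n %/ 2)%N; have mn : (m.+1 <= n.+1)%N by lia.
rewrite !lnfact_mangoldt /psi (big_cat_nat (n := m.+1)) //=.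
rewrite [in X in _ <= X](big_cat_nat (n := m.+1)) //=.
have h1 : \sum_(m.+1 <= d < n.+1) mangoldt d <=
  \sum_(m.+1 <= d < n.+1) mangoldt d * INR (n %/ d).
  apply: Rsum_le => d; rewrite mem_index_iota => /andP[h1 h2] _.
  have := mangoldt_ge0 d; have := @INR_ge1 (n %/ d).
  have -> : (0 < n %/ d)%N by rewrite divn_gt0; lia.
  move=> h3 h4; rewrite -{1}(Rmult_1_r (mangoldt d)); apply: Rmult_le_compat_l => //.
  exact: h3.
have h2 : 2 * (\sum_(1 <= d < m.+1) mangoldt d * INR (m %/ d)) <=
  \sum_(1 <= d < m.+1) mangoldt d * INR (n %/ d).
  rewrite -Rsum_mull; apply: Rsum_le => d; rewrite mem_iota1 => /andP[d0 _] _.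
  have : INR (2 * (m %/ d))%N <= INR (n %/ d).
    apply: INR_leq; rewrite leq_divRL // -mulnA (leq_trans (n := (2 * m)%N)) //.
      by rewrite leq_mul2l /= leq_divM.
    lia.
  rewrite mulnINR INR_2 => h.
  have := Rmult_le_compat_l _ _ _ (mangoldt_ge0 d) h; lra.
lra.
Qed.

Lemma psi_le n : psi n <= 4 * INR n.
Proof.
elim/ltn_ind: n => n IH; case: (posnP n) => [->|n0].
  by rewrite /psi big_geq // INR_0; lra.
have h1 := IH (n %/ 2)%N (ltn_Pdiv (ltnSn 1) n0).
have h2 := psi_half n; have h3 := lnfact_half n.
have [h4 _] := @INR_divn n 2 isT; move: h4; rewrite INR_2; lra.
Qed.

(** Replacing [n %/ d] by n/d in [lnfact_mangoldt] costs at most [psi n <= 4 n]; Stirling bounds for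
    [lnfact] do the rest after division by n. *)
Lemma mertens_mangoldt n : (0 < n)%N ->
  Rabs (\sum_(1 <= d < n.+1) mangoldt d / INR d - ln (INR n)) <= 4.
Proof.
move=> n0; have np := INR_pos n0.
set S := \sum_(1 <= d < n.+1) _.
have h1 : lnfact n <= INR n * S.
  rewrite lnfact_mangoldt /S -Rsum_mull; apply: Rsum_le => d; rewrite mem_iota1 => /andP[d0 _] _.
  have [h _] := INR_divn n d0; have := Rmult_le_compat_l _ _ _ (mangoldt_ge0 d) h.
  by rewrite /Rdiv; lra.
have h2 : INR n * S <= lnfact n + psi n.
  rewrite lnfact_mangoldt /S -Rsum_mull /psi -Rsum_add; apply: Rsum_le => d; rewrite mem_iota1 => /andP[d0 _] _.
  have [_ h] := INR_divn n d0; have := Rmult_le_compat_l _ _ _ (mangoldt_ge0 d) (Rlt_le _ _ h).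
  by rewrite /Rdiv; lra.
have h3 := psi_le n; have h4 := lnfact_le n; have h5 := lnfact_ge n.
have : INR n * (ln (INR n) - 1) <= INR n * S <= INR n * (ln (INR n) + 4) by lra.
case=> h6 h7; apply: Rabs_le.
have := Rmult_le_reg_l _ _ _ np h6; have := Rmult_le_reg_l _ _ _ np h7; lra.
Qed.

(** * From Mertens' first theorem to the second and third *)

Lemma abel_step u v r C : 0 < u -> u <= v -> v - u <= 1 -> Rabs r <= C ->
  Rabs ((v - u) / v - (ln v - ln u) + r * (/ u - / v)) <= (C + 1) * (/ u - / v).
Proof.
move=> u0 uv vu rC; have v0 : 0 < v by lra.
have iuv : 0 <= / u - / v by have := Rinv_le_contravar _ _ u0 uv; lra.
have h1 : ln (v / u) <= v / u - 1 by apply: ln_le_sub1; apply: Rdiv_lt_0_compat.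
have h2 : 1 - / (v / u) <= ln (v / u) by apply: ln_ge_sub_inv; apply: Rdiv_lt_0_compat.
rewrite ln_div // in h1 h2.
have e1 : / (v / u) = 1 - (v - u) / v by field; lra.
have e2 : v / u - 1 = (v - u) / v + (v - u) * (/ u - / v) by field; lra.
have h3 := Rmult_le_compat_r _ _ _ iuv vu.
have h4 : Rabs (r * (/ u - / v)) <= C * (/ u - / v).
  by rewrite Rabs_mult (Rabs_pos_eq _ iuv); apply: Rmult_le_compat_r.
by move: h4; split_Rabs; lra.
Qed.

Section Abel.
Variables (a : nat -> R) (C : R).
Let A n := \sum_(1 <= m < n.+1) a m.
Hypothesis hA : forall n, (0 < n)%N -> Rabs (A n - ln (INR n)) <= C.
Let S n := \sum_(1 <= m < n.+1) a m / ln (INR m).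
(** The last term is the boundary term of partial summation. With it removed, the increments are
    dominated by the telescoping differences of 1/ln n, so [E] converges at rate 1/ln n. *)
Let E n := S n - ln (ln (INR n)) - (A n - ln (INR n)) / ln (INR n).

Lemma abel_error_step n : (1 < n)%N ->
  Rabs (E n.+1 - E n) <= (C + 1) * (/ ln (INR n) - / ln (INR n.+1)).
Proof.
move=> n1; have n0 : (0 < n)%N by lia.
have u0 := ln_INR_gt0 n1; have := hA n0.
have := ln_succ_le n0.
have : / INR n <= 1 by rewrite -Rinv_1; apply: Rinv_le_contravar; [lra | exact: INR_ge1].
have : ln (INR n) <= ln (INR n.+1) by apply: ln_le; [exact: INR_pos | apply: INR_leq].
rewrite /E /S /A !(big_nat_recr n.+1) //=.
set v := ln (INR n.+1); set u := ln (INR n).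
set A0 := \sum_(1 <= _ < _) _; set S0 := \sum_(1 <= _ < _) _ => h1 h2 h3 h4.
rewrite -/u in u0; have v0 : 0 < v by lra.
have h := @abel_step u v (A0 - u) C u0 h1 (Rle_trans _ _ _ h3 h2) h4.
apply: (Rle_trans _ _ _ _ h); right; congr Rabs; field; lra.
Qed.

Lemma abel_error m n : (1 < m <= n)%N ->
  Rabs (E n - E m) <= (C + 1) * (/ ln (INR m) - / ln (INR n)).
Proof.
move=> /andP[m1]; elim: n => [|n IH]; first by lia.
rewrite leq_eqVlt => /orP[/eqP <-|]; first by rewrite /Rminus !Rplus_opp_r Rabs_R0; lra.
rewrite ltnS => h; have := IH h; have := @abel_error_step n ltac:(lia).
split_Rabs; lra.
Qed.

Lemma abel_loglog : exists c K, 0 <= K /\ forall n, (1 < n)%N ->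
  Rabs (S n - ln (ln (INR n)) - c) <= K / ln (INR n).
Proof.
set K := C + 1.
have C0 : 0 <= C by apply: (Rle_trans _ _ _ (Rabs_pos _) (@hA 1 isT)).
have key m n : (1 < m)%N -> (1 < n)%N -> E m - K / ln (INR m) <= E n + K / ln (INR n).
  move=> m1 n1; have um := Rinv_0_lt_compat _ (ln_INR_gt0 m1); have un := Rinv_0_lt_compat _ (ln_INR_gt0 n1).
  have hm := Rmult_le_pos _ _ (_ : 0 <= K) (Rlt_le _ _ um).
  have hn := Rmult_le_pos _ _ (_ : 0 <= K) (Rlt_le _ _ un).
  have {hm} := hm ltac:(rewrite /K; lra); have {hn} := hn ltac:(rewrite /K; lra).
  rewrite /Rdiv; case: (leqP m n) => mn.
    have := @abel_error m n; rewrite m1 mn => /(_ isT); rewrite -/K.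
    by split_Rabs; lra.
  have := @abel_error n m; rewrite n1 (ltnW mn) => /(_ isT); rewrite -/K.
  by split_Rabs; lra.
(* By [key], every lower end [E m - K / ln m] lies below every upper end [E n + K / ln n]; the
   supremum of the lower ends is the limit, with the rate built in. *)
have [||c [c1 c2]] := completeness (fun x => exists m, (1 < m)%N /\ x = E m - K / ln (INR m)).
- by exists (E 2 + K / ln (INR 2)) => x [m [m1 ->]]; exact: key.
- by exists (E 2 - K / ln (INR 2)); exists 2%N.
exists c, (K + C); split; first by rewrite /K; lra.
move=> n n1; have h1 := c1 _ (ex_intro _ n (conj n1 erefl)).
have h2 : c <= E n + K / ln (INR n) by apply: c2 => x [m [m1 ->]]; exact: key.
have un := Rinv_0_lt_compat _ (ln_INR_gt0 n1).
have h3 : Rabs ((A n - ln (INR n)) / ln (INR n)) <= C / ln (INR n).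
  rewrite /Rdiv Rabs_mult (Rabs_pos_eq (/ _)); last lra.
  by apply: Rmult_le_compat_r; [lra | apply: hA; lia].
move: h1 h2 h3; rewrite /E Rdiv_plus_distr; split_Rabs; lra.
Qed.
End Abel.

(** Discrete form of the antiderivative - (ln x + 1)/x of ln x / x^2; the 2 in place of 1 leaves
    room for the denominator x (x - 1). *)
Lemma ln_over_sq_telescope m : (1 < m)%N ->
  ln (INR m) / (INR m * (INR m - 1)) <=
  (ln (INR m.-1) + 2) / INR m.-1 - (ln (INR m) + 2) / INR m.
Proof.
case: m => [|[|k]] // _; rewrite [_.-1]/=.
have h := ln_succ_le (ltn0Sn k); have kp := INR_pos (ltn0Sn k).
have k1 : 1 <= INR k.+1 by apply: INR_ge1.
move: h; rewrite (S_INR k.+1); set x := INR k.+1 in kp k1 *.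
set u := ln x; set v := ln (x + 1) => h.
have hx : (x + 1) * (v - u) <= 2.
  apply: (Rle_trans _ ((x + 1) * / x)); first by apply: Rmult_le_compat_l; lra.
  have : / x <= 1 by rewrite -Rinv_1; apply: Rinv_le_contravar; lra.
  by move=> h1; have -> : (x + 1) * / x = 1 + / x; [field; lra | lra].
have -> : (u + 2) / x - (v + 2) / (x + 1) = (v - (x + 1) * (v - u) + 2) / ((x + 1) * (x + 1 - 1)).
  by field; lra.
apply: Rmult_le_compat_r; last lra.
by apply: Rlt_le; apply: Rinv_0_lt_compat; apply: Rmult_lt_0_compat; lra.
Qed.

Lemma sum_ln_over_sq n : \sum_(2 <= m < n.+1) ln (INR m) / (INR m * (INR m - 1)) <= 2.
Proof.
case: n => [|n]; first by rewrite big_geq //; lra.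
suff : \sum_(2 <= m < n.+2) ln (INR m) / (INR m * (INR m - 1)) <= 2 - (ln (INR n.+1) + 2) / INR n.+1.
  move=> h; apply: (Rle_trans _ _ _ h).
  suff : 0 <= (ln (INR n.+1) + 2) / INR n.+1 by lra.
  apply: Rdiv_le_0_compat; last exact: INR_pos.
  by have := ln_INR_ge0 n.+1; lra.
elim: n => [|n IH]; first by rewrite big_geq // INR_1 ln_1; lra.
rewrite big_nat_recr //; have := @ln_over_sq_telescope n.+2 isT.
by move: IH; rewrite [n.+2.-1]/= /=; lra.
Qed.

Lemma sum_ln_over_sq_prime n :
  0 <= \sum_(1 <= p < n.+1 | prime p) ln (INR p) / (INR p * (INR p - 1)) <= 2.
Proof.
have pos i : (1 < i)%N -> 0 <= ln (INR i) / (INR i * (INR i - 1)).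
  move=> i1; have i2 := INR_ltn i1; rewrite INR_1 in i2.
  apply: Rdiv_le_0_compat; first exact: ln_INR_ge0.
  by apply: Rmult_lt_0_compat; lra.
split; first by apply: Rsum_ge0 => i _ /prime_gt1 /pos.
apply: Rle_trans (sum_ln_over_sq n).
case: n => [|n]; first by rewrite !big_geq //; lra.
rewrite big_mkcond big_ltn //= Rplus_0_l.
apply: Rsum_le => i; rewrite mem_index_iota => /andP[i1 _] _.
by case: ifP => _; [exact: Rle_refl | exact: pos].
Qed.

Lemma geom_tail x n : 1 < x -> \sum_(2 <= k < n.+1) / x ^ k <= / (x * (x - 1)).
Proof.
move=> x1; have p0 : 0 < / (x * (x - 1)) by apply: Rinv_0_lt_compat; apply: Rmult_lt_0_compat; lra.
case: n => [|n]; first by rewrite big_geq //; lra.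
suff -> : \sum_(2 <= k < n.+2) / x ^ k = / (x * (x - 1)) - / (x ^ n.+1 * (x - 1)).
  have : 0 < / (x ^ n.+1 * (x - 1)).
    by apply: Rinv_0_lt_compat; apply: Rmult_lt_0_compat; [apply: pow_lt|]; lra.
  lra.
elim: n => [|n IH]; first by rewrite big_geq //= Rmult_1_r; lra.
rewrite big_nat_recr // IH /=; have : x ^ n <> 0 by apply: pow_nonzero; lra.
by move=> h; field; repeat split => //; lra.
Qed.

Lemma INR_expn p k : INR (p ^ k)%N = INR p ^ k.
Proof. by elim: k => [|k IH] //; rewrite expnS mulnINR IH. Qed.

Lemma mangoldt_prime p : prime p -> mangoldt p = ln (INR p).
Proof. by move=> pp; rewrite -{1}(expn1 p) mangoldt_primepow. Qed.

Lemma sum_mangoldt_nonprime n :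
  0 <= \sum_(1 <= d < n.+1 | ~~ prime d) mangoldt d / INR d <= 2.
Proof.
split.
  apply: Rsum_ge0 => d; rewrite mem_iota1 => /andP[d0 _] _.
  apply: Rdiv_le_0_compat; [exact: mangoldt_ge0 | exact: INR_pos].
have [_ h2] := sum_ln_over_sq_prime n; apply: Rle_trans h2.
(* Only an upper bound is needed, so each proper prime power is covered by some pair (p, k), and
   extra pairs just add nonnegative terms. *)
pose G p k d := if d == (p ^ k)%N then ln (INR p) / INR d else 0.
have G0 p k d : (0 < d)%N -> 0 <= G p k d.
  move=> d0; rewrite /G; case: ifP => _; last lra.
  apply: Rdiv_le_0_compat; [exact: ln_INR_ge0 | exact: INR_pos].
apply: (Rle_trans _ (\sum_(1 <= d < n.+1) \sum_(1 <= p < n.+1 | prime p) \sum_(2 <= k < n.+1) G p k d)).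
  rewrite big_mkcond; apply: Rsum_le => d; rewrite mem_iota1 => /andP[d0 dn] _.
  have S0 : 0 <= \sum_(1 <= p < n.+1 | prime p) \sum_(2 <= k < n.+1) G p k d.
    by apply: Rsum_ge0 => p _ _; apply: Rsum_ge0 => k _ _; exact: G0.
  case: ifP => // dp.
  case: (Req_dec (mangoldt d) 0) => [->|h]; first by rewrite /Rdiv Rmult_0_l.
  have [p [k [pp dE mE]]] := mangoldt_neq0 h.
  case: k dE => [|k] dE; first by move: dp; rewrite dE expn1 pp.
  have p1 := prime_gt1 pp.
  have pd : (p <= d)%N by rewrite dE expnS leq_pmulr // expn_gt0 prime_gt0.
  have kd : (k.+2 < d)%N by rewrite dE ltn_expl.
  apply: (Rle_trans _ (G p k.+2 d)); first by rewrite /G -dE eqxx mE; lra.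
  apply: (Rle_trans _ (\sum_(2 <= k < n.+1) G p k d)).
    apply: (@Rsum_le1 _ _ xpredT (fun k => G p k d)) => //.
      by rewrite mem_index_iota; lia.
    by move=> j _ _; exact: G0.
  apply: (@Rsum_le1 _ _ prime (fun p => \sum_(2 <= k < n.+1) G p k d)) => //.
    by rewrite mem_index_iota; lia.
  by move=> j _ _; apply: Rsum_ge0 => i _ _; exact: G0.
rewrite (exchange_big_dep prime) //=; apply: Rsum_le => p _ pp.
have p1 := INR_ltn (prime_gt1 pp); rewrite INR_1 in p1.
rewrite (eq_bigl xpredT) => [|d]; last by rewrite pp.
rewrite exchange_big /=.
apply: (Rle_trans _ (\sum_(2 <= k < n.+1) (ln (INR p) * / INR p ^ k))).
  apply: Rsum_le => k _ _.
  have pk : 0 <= ln (INR p) * / INR p ^ k.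
    apply: Rmult_le_pos; first exact: ln_INR_ge0.
    by apply: Rlt_le; apply: Rinv_0_lt_compat; apply: pow_lt; lra.
  rewrite /G /=.
  case: (boolP ((p ^ k)%N \in index_iota 1 n.+1)) => hin; last first.
    by rewrite big1_seq // => d /andP[_ din]; case: eqP => // dE; rewrite -dE din in hin.
  rewrite (bigD1_seq (p ^ k)%N) ?iota_uniq //= eqxx big1_seq ?Rplus_0_r.
    by rewrite INR_expn; lra.
  by move=> d /andP[/negbTE ->].
rewrite Rsum_mull; apply: Rmult_le_compat_l; first exact: ln_INR_ge0.
exact: geom_tail.
Qed.

Lemma mertens1 n : (0 < n)%N ->
  Rabs (\sum_(1 <= p < n.+1 | prime p) ln (INR p) / INR p - ln (INR n)) <= 6.
Proof.
move=> n0; have := mertens_mangoldt n0; rewrite (bigID prime) /=.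
have := sum_mangoldt_nonprime n.
rewrite [in X in _ -> X](_ : \sum_(1 <= i < n.+1 | prime i) mangoldt i / INR i =
  \sum_(1 <= i < n.+1 | prime i) ln (INR i) / INR i); last first.
  by apply: eq_bigr => p pp; rewrite mangoldt_prime.
by move=> h; split_Rabs; lra.
Qed.

Lemma mertens2 : exists M K, 0 <= K /\ forall n, (1 < n)%N ->
  Rabs (\sum_(1 <= p < n.+1 | prime p) / INR p - ln (ln (INR n)) - M) <= K / ln (INR n).
Proof.
have [|M [K [K0 h]]] := @abel_loglog (fun p => if prime p then ln (INR p) / INR p else 0) 6.
  by move=> n n0; rewrite -big_mkcond; exact: mertens1.
exists M, K; split => // n n1; have := h n n1.
rewrite [in X in X -> _](_ : \sum_(1 <= m < n.+1) _ = \sum_(1 <= p < n.+1 | prime p) / INR p) //.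
rewrite [RHS]big_mkcond; apply: Rsum_eq => // p _ _; case: ifP => pp; last by rewrite /Rdiv Rmult_0_l.
have := ln_INR_gt0 (prime_gt1 pp); have := INR_pos (prime_gt0 pp).
by move=> *; field; lra.
Qed.

Definition euler_log p : R := - ln (1 - / INR p).

Lemma euler_log_bounds p : (1 < p)%N ->
  / INR p <= euler_log p <= / INR p + / (INR p * (INR p - 1)).
Proof.
move=> p1; have := INR_ltn p1; rewrite INR_1 /euler_log => h.
have ip : / INR p < 1 by rewrite -Rinv_1; apply: Rinv_lt_contravar; lra.
have := @ln_le_sub1 (1 - / INR p); have := @ln_ge_sub_inv (1 - / INR p).
have -> : / (1 - / INR p) = 1 + / INR p + / (INR p * (INR p - 1)) by field; lra.
by move=> h1 h2; have := h1 ltac:(lra); have := h2 ltac:(lra); lra.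
Qed.

Lemma mertens3_const : exists c K, 0 <= K /\ forall n, (1 < n)%N ->
  Rabs (\sum_(1 <= p < n.+1 | prime p) euler_log p - ln (ln (INR n)) - c) <= K / ln (INR n).
Proof.
(* 8 = 6 + 2: Mertens' first theorem, and the sum of ln p / (p (p - 1)) that bounds the excess of
   [euler_log p] over 1/p. *)
have [|c [K [K0 h]]] := @abel_loglog (fun p => if prime p then euler_log p * ln (INR p) else 0) 8.
  move=> n n0; rewrite -big_mkcond /=; have := mertens1 n0.
  have := sum_ln_over_sq_prime n.
  have h1 : \sum_(1 <= p < n.+1 | prime p) ln (INR p) / INR p <=
     \sum_(1 <= p < n.+1 | prime p) euler_log p * ln (INR p).
    apply: Rsum_le => p _ pp; rewrite /Rdiv Rmult_comm; apply: Rmult_le_compat_r.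
      exact: ln_INR_ge0.
    by have := euler_log_bounds (prime_gt1 pp); lra.
  have h2 : \sum_(1 <= p < n.+1 | prime p) euler_log p * ln (INR p) <=
     \sum_(1 <= p < n.+1 | prime p) ln (INR p) / INR p +
     \sum_(1 <= p < n.+1 | prime p) ln (INR p) / (INR p * (INR p - 1)).
    rewrite -Rsum_add; apply: Rsum_le => p _ pp.
    have [_ h2] := euler_log_bounds (prime_gt1 pp).
    have := Rmult_le_compat_r _ _ _ (ln_INR_ge0 p) h2; rewrite /Rdiv; lra.
  by move: h1 h2 => h1 h2 h3; split_Rabs; lra.
exists c, K; split => // n n1; have := h n n1.
rewrite [in X in X -> _](_ : \sum_(1 <= m < n.+1) _ = \sum_(1 <= p < n.+1 | prime p) euler_log p) //.
rewrite [RHS]big_mkcond; apply: Rsum_eq => // p _ _; case: ifP => pp; last by rewrite /Rdiv Rmult_0_l.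
by have := ln_INR_gt0 (prime_gt1 pp); move=> *; field; lra.
Qed.

(** * Euler products for zeta(1 + s) *)

Definition coprime_sum (f : nat -> R) x (L : seq nat) : R :=
  \sum_(1 <= n < x.+1 | all (fun p => ~~ (p %| n)) L) f n.

(** Legendre's identity, one prime at a time: among multiples p m, divisibility by primes of [L]
    depends on m only. It serves both the Euler products ([f = zeta_term s]) and the sieve
    ([f = 1]). *)
Lemma coprime_sum_cons f x p L : prime p -> p \notin L -> all prime L ->
  (forall m, (0 < m)%N -> f (p * m)%N = f p * f m) ->
  coprime_sum f x (p :: L) = coprime_sum f x L - f p * coprime_sum f (x %/ p) L.
Proof.
move=> pp pL aL fM; rewrite /coprime_sum [in X in _ = X - _](bigID (fun n => p %| n)) /=.
rewrite [X in X + _](_ : _ = f p * coprime_sum f (x %/ p) L); last first.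
  rewrite (eq_bigl (fun i => (p %| i) && all (fun p => ~~ (p %| i)) L)); last by move=> i; rewrite andbC.
  rewrite (Rsum_multiples x _ f (prime_gt0 pp)) /coprime_sum -Rsum_mull.
  apply: Rsum_eq => [m|m]; last by rewrite mem_iota1 => /andP[m0 _] _; exact: fM.
  move=> _; apply: eq_in_all => q qL; have qp := allP aL _ qL.
  rewrite Euclid_dvdM // dvdn_prime2 //; case: (q =P p) => // e.
  by rewrite -e qL in pL.
rewrite [X in _ + X - _](_ : _ = coprime_sum f x (p :: L)); last first.
  by apply: eq_bigl => i /=; rewrite andbC.
by rewrite /coprime_sum /=; lra.
Qed.

Lemma coprime_sum_ge0 f x L : (forall n, (0 < n)%N -> 0 <= f n) -> 0 <= coprime_sum f x L.
Proof. by move=> h; apply: Rsum_ge0 => i; rewrite mem_iota1 => /andP[i0 _] _; exact: h. Qed.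

Lemma coprime_sum_le f x y L : (forall n, (0 < n)%N -> 0 <= f n) -> (x <= y)%N ->
  coprime_sum f x L <= coprime_sum f y L.
Proof. by move=> h xy; apply: Rsum_extend => // i /andP[i0 _] _; exact: h. Qed.

Definition primes_upto n := [seq p <- index_iota 1 n.+1 | prime p].

Lemma primes_upto_prime n : all prime (primes_upto n).
Proof. exact: filter_all. Qed.

Lemma primes_upto_uniq n : uniq (primes_upto n).
Proof. by apply: filter_uniq; exact: iota_uniq. Qed.

Lemma mem_primes_upto n p : (p \in primes_upto n) = prime p && (p <= n)%N.
Proof.
rewrite mem_filter mem_iota1; case: (boolP (prime p)) => //= pp.
by rewrite prime_gt0.
Qed.

Lemma coprime_sum_primes f x y : (0 < x)%N -> (x <= y)%N ->
  coprime_sum f x (primes_upto y) = f 1%N.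
Proof.
move=> x0 xy; rewrite /coprime_sum big_mkcond (bigD1_seq 1%N) ?iota_uniq ?mem_iota1 //=.
have -> : all (fun p => ~~ (p %| 1)) (primes_upto y).
  apply/allP => p; rewrite mem_primes_upto => /andP[pp _]; rewrite dvdn1.
  by apply: contraTneq pp => ->.
rewrite big1_seq ?Rplus_0_r // => n /andP[n1]; rewrite mem_iota1 => /andP[n0 nx].
case: ifP => // /allP h; exfalso.
have n2 : (1 < n)%N by rewrite ltn_neqAle eq_sym n1.
have /h : pdiv n \in primes_upto y.
  by rewrite mem_primes_upto pdiv_prime //= (leq_trans (pdiv_leq n0)) // (leq_trans nx).
by rewrite pdiv_dvd.
Qed.

(** For n >= 1 this is n^(-s), so that [zeta_term s n] below is n^(-1-s). *)
Definition npow s n := exp (- s * ln (INR n)).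

Lemma npow_gt0 s n : 0 < npow s n. Proof. exact: exp_pos. Qed.

Lemma npow_le1 s n : 0 <= s -> npow s n <= 1.
Proof.
move=> s0; rewrite /npow -exp_0.
have := Rmult_le_pos _ _ s0 (ln_INR_ge0 n).
by case=> h; [apply: Rlt_le; apply: exp_increasing; lra | right; congr exp; lra].
Qed.

Lemma npow1 s : npow s 1 = 1.
Proof. by rewrite /npow INR_1 ln_1 Rmult_0_r exp_0. Qed.

Definition zeta_term s n := npow s n / INR n.

Lemma zeta_term_ge0 s n : (0 < n)%N -> 0 <= zeta_term s n.
Proof. by move=> n0; apply: Rdiv_le_0_compat; [exact: Rlt_le (npow_gt0 s n) | exact: INR_pos]. Qed.

Lemma zeta_termM s m n : (0 < m)%N -> (0 < n)%N -> zeta_term s (m * n) = zeta_term s m * zeta_term s n.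
Proof.
move=> m0 n0; have := INR_pos m0; have := INR_pos n0 => n1 m1.
rewrite /zeta_term /npow mulnINR ln_mult // Rmult_plus_distr_l exp_plus; field; lra.
Qed.

Lemma zeta_term_lt1 s p : 0 < s -> (1 < p)%N -> zeta_term s p < 1.
Proof.
move=> s0 p1; have ip := INR_ltn p1; rewrite INR_1 in ip.
have := npow_le1 p (Rlt_le _ _ s0) => h; rewrite /zeta_term.
apply: (Rmult_lt_reg_r (INR p)); first lra.
by rewrite /Rdiv Rmult_assoc Rinv_l; lra.
Qed.

Lemma exp_sub1_ge x : x <= exp x - 1.
Proof. by have := exp_ineq1_le x; lra. Qed.

(** Comparison of the zeta series with an integral, in telescoping form: the middle term is the
    integral of s x^(-1-s) over [n, n + 1]. *)
Lemma npow_step s n : 0 < s -> (0 < n)%N ->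
  s * zeta_term s n.+1 <= npow s n - npow s n.+1 <= s * zeta_term s n.
Proof.
move=> s0 n0; have h1 := ln_succ_le n0; have h2 := ln_succ_ge n0.
have g1 := npow_gt0 s n; have g2 := npow_gt0 s n.+1.
set d := ln (INR n.+1) - ln (INR n) in h1 h2.
have e1 : npow s n = npow s n.+1 * exp (s * d).
  by rewrite /npow -exp_plus; congr exp; rewrite /d; ring.
have e2 : npow s n.+1 = npow s n * exp (- (s * d)).
  by rewrite /npow -exp_plus; congr exp; rewrite /d; ring.
split.
  have -> : npow s n - npow s n.+1 = npow s n.+1 * (exp (s * d) - 1) by rewrite e1; ring.
  have -> : s * zeta_term s n.+1 = npow s n.+1 * (s * / INR n.+1) by rewrite /zeta_term /Rdiv; ring.
  apply: Rmult_le_compat_l; first lra.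
  apply: (Rle_trans _ (s * d)); last exact: exp_sub1_ge.
  by apply: Rmult_le_compat_l; lra.
have -> : npow s n - npow s n.+1 = npow s n * (1 - exp (- (s * d))) by rewrite e2; ring.
have -> : s * zeta_term s n = npow s n * (s * / INR n) by rewrite /zeta_term /Rdiv; ring.
apply: Rmult_le_compat_l; first lra.
have := exp_sub1_ge (- (s * d)).
have := Rmult_le_compat_l s _ _ (Rlt_le _ _ s0) h1; lra.
Qed.

Definition zeta_sum s x := \sum_(1 <= n < x.+1) zeta_term s n.

Lemma zeta_sum_upper s x : 0 < s -> zeta_sum s x <= 1 + / s.
Proof.
move=> s0; have i0 := Rinv_0_lt_compat _ s0; rewrite /zeta_sum.
case: x => [|x]; first by rewrite big_geq //; lra.
suff : s * \sum_(1 <= n < x.+2) zeta_term s n <= s + 1 - npow s x.+1.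
  move=> h; have g := npow_gt0 s x.+1; apply: (Rmult_le_reg_l s) => //.
  by have -> : s * (1 + / s) = s + 1; [field; lra | lra].
elim: x => [|x IH]; first by rewrite big_nat1 /zeta_term npow1 INR_1; lra.
rewrite big_nat_recr //=; have [h _] := npow_step s0 (ltn0Sn x); lra.
Qed.

Lemma zeta_sum_lower s x : 0 < s -> 1 - npow s x.+1 <= s * zeta_sum s x.
Proof.
move=> s0; rewrite /zeta_sum; elim: x => [|x IH]; first by rewrite big_geq // npow1; lra.
rewrite big_nat_recr //=; have [_ h] := npow_step s0 (ltn0Sn x); lra.
Qed.

Lemma INR_eventually_ge r : exists N, forall n, (N <= n)%N -> r <= INR n.
Proof.
have [N h] := RIneq.INR_unbounded r; exists N => n /INR_leq; lra.
Qed.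

Lemma ln_INR_eventually_ge r : exists N, forall n, (N <= n)%N -> r <= ln (INR n).
Proof.
have [N h] := INR_eventually_ge (exp r); exists N => n /h hn.
rewrite -(ln_exp r); apply: ln_le => //; exact: exp_pos.
Qed.

Lemma euler_prod_pos s L : 0 < s -> all prime L -> 0 < \prod_(p <- L) (1 - zeta_term s p).
Proof.
move=> s0; elim: L => [|p L IH] /=; first by rewrite big_nil; lra.
move=> /andP[pp aL]; rewrite big_cons; apply: Rmult_lt_0_compat; last exact: IH.
by have := zeta_term_lt1 s0 (prime_gt1 pp); lra.
Qed.

(** Adding p to [L] removes [zeta_term s p] times a sum up to x/p, which is at most the sum up to x;
    so the sum keeps at least the fraction [1 - zeta_term s p]. *)
Lemma euler_prod_lower s x L : 0 < s -> all prime L -> uniq L ->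
  zeta_sum s x * \prod_(p <- L) (1 - zeta_term s p) <= coprime_sum (zeta_term s) x L.
Proof.
move=> s0; elim: L => [|p L IH] /=.
  by rewrite big_nil /coprime_sum /zeta_sum /=; lra.
move=> /andP[pp aL] /andP[pL uL]; rewrite big_cons coprime_sum_cons //; last first.
  by move=> m; apply: zeta_termM; exact: prime_gt0.
have h := IH aL uL.
have h1 : coprime_sum (zeta_term s) (x %/ p) L <= coprime_sum (zeta_term s) x L.
  apply: coprime_sum_le; [exact: zeta_term_ge0 | exact: leq_div].
have h2 := zeta_term_lt1 s0 (prime_gt1 pp); have h3 := zeta_term_ge0 s (prime_gt0 pp).
have h4 := Rmult_le_compat_l _ _ _ h3 h1.
have h5 := Rmult_le_compat_l (1 - zeta_term s p) _ _ ltac:(lra) h; lra.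
Qed.

(** For finite x the ranges x and x/p differ and the inequality used for the lower bound cannot be
    reversed. As x tends to infinity both have the same limit, so the sieved sum tends to z times
    the product, and it is at least its term n = 1. *)
Lemma euler_prod_upper s L : 0 < s -> all prime L -> uniq L ->
  1 <= (1 + / s) * \prod_(p <- L) (1 - zeta_term s p).
Proof.
move=> s0 aL uL.
have [z hz] : ex_finite_lim_seq (zeta_sum s).
  apply: (ex_finite_lim_seq_incr _ (1 + / s)) => n; last exact: zeta_sum_upper.
  by rewrite /zeta_sum (big_nat_recr n.+1) //=; have := zeta_term_ge0 s (ltn0Sn n); lra.
have zle : z <= 1 + / s.
  apply: (is_lim_seq_le _ _ (Rbar.Finite z) (Rbar.Finite (1 + / s)) _ hz (is_lim_seq_const _)) => n.
  exact: zeta_sum_upper.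
have lim : is_lim_seq (fun x => coprime_sum (zeta_term s) x L) (z * \prod_(p <- L) (1 - zeta_term s p)).
  elim: L aL uL => [|p L IH] /=.
    move=> _ _; rewrite big_nil Rmult_1_r; apply: is_lim_seq_ext hz => n.
    by rewrite /coprime_sum /zeta_sum.
  move=> /andP[pp aL] /andP[pL uL]; rewrite big_cons.
  apply: (is_lim_seq_ext (fun x => coprime_sum (zeta_term s) x L -
    zeta_term s p * coprime_sum (zeta_term s) (x %/ p) L)).
    by move=> n; rewrite coprime_sum_cons // => m; apply: zeta_termM; exact: prime_gt0.
  set D := \prod_(_ <- L) _.
  have -> : z * ((1 - zeta_term s p) * D) = z * D - zeta_term s p * (z * D) by ring.
  have h := IH aL uL.
  apply: is_lim_seq_minus' => //; apply: (is_lim_seq_scal_l _ _ (Rbar.Finite _)).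
  apply: (is_lim_seq_subseq (fun x => coprime_sum (zeta_term s) x L) _ (fun x => (x %/ p)%N)) h.
  move=> P [N hN]; exists (N * p)%N => n hn; apply: hN; apply/leP.
  by rewrite leq_divRL ?prime_gt0 //; apply/leP.
have h1 : 1 <= z * \prod_(p <- L) (1 - zeta_term s p).
  apply: (is_lim_seq_le_loc _ _ (Rbar.Finite 1) (Rbar.Finite _) _ (is_lim_seq_const _) lim).
  exists 1%N => n hn; rewrite /coprime_sum.
  have -> : 1 = zeta_term s 1 by rewrite /zeta_term npow1 INR_1; field.
  apply: (@Rsum_le1 _ _ _ (zeta_term s)).
  - by rewrite mem_iota1; apply/leP.
  - apply/allP => p /(allP aL) pp; rewrite dvdn1; by apply: contraTneq pp => ->.
  - by move=> j; rewrite mem_iota1 => /andP[j0 _] _; exact: zeta_term_ge0.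
have := Rmult_le_compat_r _ _ _ (Rlt_le _ _ (euler_prod_pos s0 aL)) zle; lra.
Qed.

Lemma ln_prod (I : eqType) (L : seq I) F : (forall i, i \in L -> 0 < F i) ->
  ln (\prod_(i <- L) F i) = \sum_(i <- L) ln (F i) /\ 0 < \prod_(i <- L) F i.
Proof.
elim: L => [|i L IH] h; first by rewrite !big_nil ln_1; split=> //; lra.
have [h1 h2] := IH (fun j jL => h j (mem_behead (s := i :: L) jL)).
have h0 := h i (mem_head _ _).
by rewrite !big_cons ln_mult // h1; split => //; apply: Rmult_lt_0_compat.
Qed.

Definition zeta_log s x := \sum_(1 <= p < x.+1 | prime p) - ln (1 - zeta_term s p).

Lemma zeta_logE s x : 0 < s -> zeta_log s x = - ln (\prod_(p <- primes_upto x) (1 - zeta_term s p)).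
Proof.
move=> s0; have [|-> _] := @ln_prod _ (primes_upto x) (fun p => 1 - zeta_term s p).
  by move=> p; rewrite mem_primes_upto => /andP[/prime_gt1 p1 _]; have := zeta_term_lt1 s0 p1; lra.
by rewrite -Rsum_opp /primes_upto big_filter.
Qed.

Lemma zeta_log_upper s x : 0 < s -> zeta_log s x <= ln (1 + / s).
Proof.
move=> s0; have i0 := Rinv_0_lt_compat _ s0; rewrite zeta_logE //.
have h := euler_prod_upper s0 (primes_upto_prime x) (primes_upto_uniq x).
have h1 := euler_prod_pos s0 (primes_upto_prime x).
have := ln_ge0 h; rewrite ln_mult //; lra.
Qed.

Lemma zeta_log_lower s : 0 < s -> exists N, forall x, (N <= x)%N -> - ln s - s <= zeta_log s x.
Proof.
(* Once (x + 1)^(-s) <= [e], the zeta sum satisfies s [zeta_sum s x] >= exp (-s), whose logarithm is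
   the term - s of the conclusion. *)
move=> s0; set e := 1 - exp (- s).
have e0 : 0 < e.
  by rewrite /e; have := exp_increasing (- s) 0 ltac:(lra); rewrite exp_0; lra.
have [N hN] := ln_INR_eventually_ge (- ln e / s); exists N.+1 => x Nx.
have h1 : npow s x.+1 <= e.
  rewrite -(exp_ln e) // /npow.
  have := hN x.+1 ltac:(lia) => h.
  have := Rmult_le_compat_l s _ _ (Rlt_le _ _ s0) h.
  have -> : s * (- ln e / s) = - ln e by field; lra.
  by case=> h2; [apply: Rlt_le; apply: exp_increasing; lra | right; congr exp; lra].
have h2 := zeta_sum_lower x s0.
have h3 := @euler_prod_lower s x _ s0 (primes_upto_prime x) (primes_upto_uniq x).
rewrite coprime_sum_primes // in h3; last by lia.
rewrite /zeta_term npow1 INR_1 -/(zeta_term s) in h3.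
have h4 := euler_prod_pos s0 (primes_upto_prime x).
have h5 : exp (- s) <= s * zeta_sum s x by rewrite /e in h1; lra.
have zp : 0 < zeta_sum s x.
  by apply: (Rmult_lt_reg_l s) => //; have := exp_pos (- s); lra.
rewrite zeta_logE //; set D := \prod_(_ <- _) _ in h3 h4 *.
have h6 : ln (zeta_sum s x * D) <= ln (1 / 1) by apply: ln_le => //; apply: Rmult_lt_0_compat.
rewrite ln_mult // Rdiv_1_r ln_1 in h6.
have h7 := ln_le _ _ (exp_pos (- s)) h5.
rewrite ln_exp ln_mult // in h7; lra.
Qed.

(** With t = p^(-s) in (0, 1], the function t -> - ln (1 - t/p) is convex and vanishes at 0, which
    gives the first bound. The second is its tangent at t = 1 together with 1 - t <= s ln p. *)
Lemma euler_log_npow s p : 0 < s -> prime p ->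
  - ln (1 - zeta_term s p) <= npow s p * euler_log p <=
  - ln (1 - zeta_term s p) + s * (ln (INR p) / (INR p * (INR p - 1))).
Proof.
move=> s0 pp; have p1 := INR_ltn (prime_gt1 pp); rewrite INR_1 in p1.
have t0 := npow_gt0 s p; have t1 := npow_le1 p (Rlt_le _ _ s0).
have t2 : 1 - npow s p <= s * ln (INR p).
  by rewrite /npow; have := exp_sub1_ge (- s * ln (INR p)); lra.
have [lp0 _] := euler_log_bounds (prime_gt1 pp).
have w1 := zeta_term_lt1 s0 (prime_gt1 pp); rewrite /zeta_term in w1 *.
rewrite /euler_log in lp0 *; set t := npow s p in t0 t1 t2 w1 *; set q := INR p in p1 t2 w1 lp0 *.
have iq1 : / q < 1 by rewrite -Rinv_1; apply: Rinv_lt_contravar; lra.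
have tangent y w : 0 < y -> 0 < w -> ln y <= ln w + (y - w) / w.
  move=> y0 w0; have := @ln_le_sub1 (y / w) (Rdiv_lt_0_compat _ _ y0 w0).
  by rewrite ln_div // (_ : (y - w) / w = y / w - 1); [lra | field; lra].
split.
  have h1 := @tangent 1 (1 - t / q) ltac:(lra) ltac:(lra).
  have h2 := @tangent (1 - / q) (1 - t / q) ltac:(lra) ltac:(lra).
  rewrite ln_1 in h1.
  have h3 := Rmult_le_compat_l (1 - t) _ _ ltac:(lra) h1.
  have h4 := Rmult_le_compat_l t _ _ ltac:(lra) h2.
  have h5 : (1 - t) * ((1 - (1 - t / q)) / (1 - t / q)) + t * ((1 - / q - (1 - t / q)) / (1 - t / q)) = 0.
    by field; split; lra.
  lra.
have h1 := @tangent (1 - t / q) (1 - / q) ltac:(lra) ltac:(lra).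
have h2 : (1 - t / q - (1 - / q)) / (1 - / q) = (1 - t) / q + (1 - t) / (q * (q - 1)) by field; lra.
have h3 : (1 - t) / (q * (q - 1)) <= s * (ln q / (q * (q - 1))).
  rewrite /Rdiv -Rmult_assoc; apply: Rmult_le_compat_r => //.
  by apply: Rlt_le; apply: Rinv_0_lt_compat; apply: Rmult_lt_0_compat; lra.
have h4 := Rmult_le_compat_r (- ln (1 - / q) - / q) _ _ ltac:(lra) t1.
have : (1 - t) / q = / q - t * / q by field; lra.
rewrite /Rdiv in h1 h2 h3 h4 *; lra.
Qed.

Lemma euler_log_npow_sum s x : 0 < s ->
  zeta_log s x <= \sum_(1 <= p < x.+1 | prime p) npow s p * euler_log p <= zeta_log s x + 2 * s.
Proof.
move=> s0; split; first by apply: Rsum_le => p _ pp; have := euler_log_npow s0 pp; lra.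
have [_ h] := sum_ln_over_sq_prime x.
apply: (Rle_trans _ (zeta_log s x + s * \sum_(1 <= p < x.+1 | prime p) ln (INR p) / (INR p * (INR p - 1)))).
  rewrite /zeta_log -Rsum_mull -Rsum_add; apply: Rsum_le => p _ pp; have := euler_log_npow s0 pp; lra.
have := Rmult_le_compat_l s _ _ (Rlt_le _ _ s0) h; lra.
Qed.

(** * The constant in Mertens' third theorem *)

Definition nat_floor (x : R) : nat := Z.to_nat (Int_part x).

Lemma nat_floorP x : 0 <= x -> INR (nat_floor x) <= x < INR (nat_floor x) + 1.
Proof.
move=> x0; have [h1 h2] := base_Int_part x.
have z0 : (0 <= Int_part x)%Z by have : (-1 < Int_part x)%Z; [apply: lt_IZR; lra | lia].
by rewrite /nat_floor INR_IZR_INZ Z2Nat.id //; lra.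
Qed.

Lemma leq_INR m n : INR m <= INR n -> (m <= n)%N.
Proof. by move=> /INR_le /leP. Qed.

Lemma exp1_ge2 : 2 <= exp 1.
Proof. have := exp_ineq1_le 1; lra. Qed.

(** Cutting the primes at the powers of e puts ln p into the unit cells (k - 1, k], where a sum over
    primes can be compared with a sum over k. *)
Definition exp_floor k := nat_floor (exp (INR k)).

Lemma exp_floorP k : INR (exp_floor k) <= exp (INR k) < INR (exp_floor k) + 1.
Proof. by apply: nat_floorP; apply: Rlt_le; exact: exp_pos. Qed.

Lemma exp_floor0 : exp_floor 0 = 1%N.
Proof.
have := exp_floorP 0; rewrite INR_0 exp_0 => -[h1 h2].
apply/eqP; rewrite eqn_leq; apply/andP; split; apply: leq_INR; rewrite INR_1 //.
have : (0 < exp_floor 0)%N; last by move=> /INR_ge1.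
rewrite lt0n; apply/eqP => h; rewrite h INR_0 in h2; lra.
Qed.

Lemma exp_floor_mono k : (exp_floor k <= exp_floor k.+1)%N.
Proof.
rewrite -ltnS; apply/ltP; apply: INR_lt; rewrite (S_INR (exp_floor _)).
have [h1 _] := exp_floorP k; have [_ h2] := exp_floorP k.+1.
have := exp_increasing (INR k) (INR k.+1); rewrite S_INR; move/(_ ltac:(lra)).
rewrite S_INR in h2; lra.
Qed.

Lemma exp_floor_gt1 k : (1 < exp_floor k.+1)%N.
Proof.
have [_ h1] := exp_floorP k.+1.
have h2 : (2 < (exp_floor k.+1).+1)%N; last by lia.
apply/ltP; apply: INR_lt; rewrite (S_INR (exp_floor _)) INR_2.
have h3 := exp1_ge2; have h4 := pos_INR k; rewrite (S_INR k) exp_plus in h1.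
have h5 : 1 <= exp (INR k) by have := exp_ineq1_le (INR k); lra.
have := Rmult_le_compat_l 1 _ _ ltac:(lra) h5.
have := Rmult_le_compat_r (exp 1) _ _ ltac:(lra) h5; lra.
Qed.

Lemma ln_exp_floor k : (0 < k)%N -> INR k - 1 <= ln (INR (exp_floor k)) <= INR k.
Proof.
move=> k0; have [h1 h2] := exp_floorP k.
have n0 : 0 < INR (exp_floor k).
  by case: k k0 {h1 h2} => // k _; apply: INR_pos; have := exp_floor_gt1 k; lia.
split; last by rewrite -[X in _ <= X]ln_exp; exact: ln_le.
rewrite -[X in X <= _]ln_exp; apply: ln_le; first exact: exp_pos.
have h3 : exp (INR k) = exp (INR k - 1) * exp 1 by rewrite -exp_plus; congr exp; ring.
have h4 := exp1_ge2.
have h5 : 1 <= exp (INR k - 1) by have := exp_ineq1_le (INR k - 1); have := INR_ge1 k0; lra.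
have := Rmult_le_compat_l (exp (INR k - 1)) _ _ ltac:(lra) h4; lra.
Qed.

Definition euler_log_sum k := \sum_(1 <= p < (exp_floor k).+1 | prime p) euler_log p.

Lemma euler_log_sum0 : euler_log_sum 0 = 0.
Proof. by rewrite /euler_log_sum exp_floor0 big_mkcond big_nat1. Qed.

Lemma exp_pow s k : exp (- s) ^ k = exp (- s * INR k).
Proof.
elim: k => [|k IH]; first by rewrite INR_0 Rmult_0_r exp_0.
by rewrite /= IH -exp_plus S_INR; congr exp; ring.
Qed.

Lemma euler_log_ge0 p : prime p -> 0 <= euler_log p.
Proof.
move=> pp; have [h _] := euler_log_bounds (prime_gt1 pp).
have := Rinv_0_lt_compat _ (INR_pos (prime_gt0 pp)); lra.
Qed.

(** For e^(k-1) < p <= e^k, the weight p^(-s) lies between e^(-sk) and e^s e^(-sk). *)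
Lemma euler_log_sum_transform s K : 0 < s ->
  \sum_(1 <= k < K.+1) (euler_log_sum k - euler_log_sum k.-1) * exp (- s) ^ k <=
  \sum_(1 <= p < (exp_floor K).+1 | prime p) npow s p * euler_log p <=
  exp s * \sum_(1 <= k < K.+1) (euler_log_sum k - euler_log_sum k.-1) * exp (- s) ^ k.
Proof.
move=> s0; elim: K => [|K IH].
  by rewrite exp_floor0 big_geq // big_mkcond big_nat1 /=; lra.
have mono := exp_floor_mono K.
rewrite big_nat_recr //= -/(exp (- s) ^ K.+1).
rewrite (big_cat_nat (n := (exp_floor K).+1) (p := (exp_floor K.+1).+1)) //=.
have -> : euler_log_sum K.+1 - euler_log_sum K =
    \sum_((exp_floor K).+1 <= p < (exp_floor K.+1).+1 | prime p) euler_log p.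
  by rewrite /euler_log_sum (big_cat_nat (n := (exp_floor K).+1)) //=; lra.
set B := \sum_((exp_floor K).+1 <= p < (exp_floor K.+1).+1 | prime p) euler_log p.
set D := \sum_((exp_floor K).+1 <= p < (exp_floor K.+1).+1 | prime p) (npow s p * euler_log p).
have bnd p : p \in index_iota (exp_floor K).+1 (exp_floor K.+1).+1 -> prime p ->
    exp (- s) ^ K.+1 <= npow s p <= exp s * exp (- s) ^ K.+1.
  rewrite mem_index_iota => /andP[a b] pp; have p0 := INR_pos (prime_gt0 pp).
  have h1 : ln (INR p) <= INR K.+1.
    rewrite -[X in _ <= X]ln_exp; apply: ln_le => //.
    by have [h _] := exp_floorP K.+1; apply: Rle_trans h; apply: INR_leq.
  have h2 : INR K <= ln (INR p).
    rewrite -[X in X <= _]ln_exp; apply: ln_le; first exact: exp_pos.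
    have [_ h] := exp_floorP K; apply: Rlt_le; apply: (Rlt_le_trans _ _ _ h).
    by rewrite -S_INR; apply: INR_leq.
  rewrite exp_pow -exp_plus /npow.
  have e x y : x <= y -> exp x <= exp y.
    by case=> h; [apply: Rlt_le; exact: exp_increasing | rewrite h; lra].
  have h3 := Rmult_le_compat_l s _ _ (Rlt_le _ _ s0) h1.
  have h4 := Rmult_le_compat_l s _ _ (Rlt_le _ _ s0) h2.
  by rewrite S_INR in h3 *; split; apply: e; lra.
have h1 : B * exp (- s) ^ K.+1 <= D.
  rewrite /B /D -Rsum_mulr; apply: Rsum_le => p hp pp; rewrite Rmult_comm.
  by apply: Rmult_le_compat_r; [exact: euler_log_ge0 | have := bnd p hp pp; lra].
have h2 : D <= exp s * (B * exp (- s) ^ K.+1).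
  rewrite /B /D -Rsum_mulr -Rsum_mull; apply: Rsum_le => p hp pp.
  have -> : exp s * (euler_log p * exp (- s) ^ K.+1) = exp s * exp (- s) ^ K.+1 * euler_log p by ring.
  by apply: Rmult_le_compat_r; [exact: euler_log_ge0 | have := bnd p hp pp; lra].
rewrite -/(exp (- s) ^ K.+1) Rmult_plus_distr_l; lra.
Qed.

Lemma abel_finite (d : nat -> R) delta r K :
  \sum_(1 <= k < K.+1) (d k - d k.-1) * r ^ k + d 0%N - delta =
  (d K - delta) * r ^ K + (1 - r) * \sum_(0 <= k < K) (d k - delta) * r ^ k.
Proof.
elim: K => [|K IH]; first by rewrite !big_geq //=; lra.
rewrite (big_nat_recr K.+1 1) // (big_nat_recr K 0) //=.
set S := \sum_(1 <= k < K.+1) (d k - d k.-1) * r ^ k in IH *.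
set T := \sum_(0 <= k < K) (d k - delta) * r ^ k in IH *.
have -> : S + (d K.+1 - d K) * (r * r ^ K) + d 0%N - delta =
  (S + d 0%N - delta) + (d K.+1 - d K) * (r * r ^ K) by ring.
by rewrite IH; ring.
Qed.

Lemma geom_sum r K : (1 - r) * \sum_(0 <= k < K) r ^ k = 1 - r ^ K.
Proof.
elim: K => [|K IH]; first by rewrite big_geq //=; ring.
by rewrite big_nat_recr //= Rmult_plus_distr_l IH; ring.
Qed.

(** Quantitative Abelian theorem. After summation by parts the weights (1 - r) r^k, together with
    the boundary weight r^K, have total mass 1: the indices from [K0] on cost at most [eps], and
    each earlier one has weight at most 1 - r. *)
Lemma abel_finite_bound (d : nat -> R) delta eps r K0 K : 0 < r < 1 -> (K0 <= K)%N ->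
  (forall k, (K0 <= k)%N -> Rabs (d k - delta) <= eps) ->
  Rabs (\sum_(1 <= k < K.+1) (d k - d k.-1) * r ^ k + d 0%N - delta) <=
  eps + (1 - r) * \sum_(0 <= k < K0) Rabs (d k - delta).
Proof.
move=> [r0 r1] KK h; rewrite abel_finite.
have e0 : 0 <= eps by apply: (Rle_trans _ _ _ (Rabs_pos _) (h K0 (leqnn _))).
have rk k : 0 < r ^ k <= 1.
  by split; [apply: pow_lt | rewrite -(pow1 k); apply: pow_incr; lra].
have h1 : Rabs ((d K - delta) * r ^ K) <= eps * r ^ K.
  rewrite Rabs_mult (Rabs_pos_eq (r ^ K)); last by have := rk K; lra.
  by apply: Rmult_le_compat_r; [have := rk K; lra | exact: h].
have h2 : Rabs (\sum_(0 <= k < K) (d k - delta) * r ^ k) <=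
   \sum_(0 <= k < K0) Rabs (d k - delta) + eps * \sum_(0 <= k < K) r ^ k.
  apply: (Rle_trans _ _ _ (Rsum_abs _ _ _)).
  rewrite (big_cat_nat (n := K0)) //= [in X in _ <= _ + _ * X](big_cat_nat (n := K0)) //=.
  have : \sum_(0 <= k < K0) Rabs ((d k - delta) * r ^ k) <= \sum_(0 <= k < K0) Rabs (d k - delta).
    apply: Rsum_le => k _ _; rewrite Rabs_mult (Rabs_pos_eq (r ^ k)); last by have := rk k; lra.
    have := rk k => hk; have := Rmult_le_compat_l (Rabs (d k - delta)) _ _ (Rabs_pos _) (proj2 hk); lra.
  have : \sum_(K0 <= k < K) Rabs ((d k - delta) * r ^ k) <= eps * \sum_(K0 <= k < K) r ^ k.
    rewrite -Rsum_mull; apply: Rsum_le => k; rewrite mem_index_iota => /andP[hk _] _.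
    rewrite Rabs_mult (Rabs_pos_eq (r ^ k)); last by have := rk k; lra.
    by apply: Rmult_le_compat_r; [have := rk k; lra | exact: h].
  have : 0 <= eps * \sum_(0 <= k < K0) r ^ k.
    by apply: Rmult_le_pos => //; apply: Rsum_ge0 => k _ _; have := rk k; lra.
  lra.
have h3 := Rmult_le_compat_l (1 - r) _ _ ltac:(lra) h2.
have h4 := geom_sum r K.
apply: (Rle_trans _ _ _ (Rabs_triang _ _)).
rewrite (Rabs_mult (1 - r)) (Rabs_pos_eq (1 - r)); last lra.
set T := \sum_(0 <= k < K) r ^ k in h3 h4 *; set M := \sum_(0 <= k < K0) Rabs (d k - delta) in h3 *.
have : (1 - r) * (M + eps * T) = (1 - r) * M + eps * ((1 - r) * T) by ring.
rewrite h4; lra.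
Qed.

Lemma log_series_derive K x : x < 1 ->
  is_derive (fun x => - ln (1 - x) - \sum_(1 <= k < K.+1) x ^ k / INR k) x (x ^ K / (1 - x)).
Proof.
move=> x1; elim: K => [|K IH].
  apply: (is_derive_ext (fun x => - ln (1 - x))); first by move=> t; rewrite big_geq // Rminus_0_r.
  by auto_derive; [lra | rewrite /=; field; lra].
apply: (is_derive_ext (fun x => (- ln (1 - x) - \sum_(1 <= k < K.+1) x ^ k / INR k) - x ^ K.+1 / INR K.+1)).
  by move=> t; rewrite [in RHS]big_nat_recr //=; lra.
have -> : x ^ K.+1 / (1 - x) = x ^ K / (1 - x) - x ^ K by rewrite /=; field; lra.
apply: (is_derive_minus (V := R_NormedModule)) => //.
have := INR_pos (ltn0Sn K) => Kp.
by auto_derive => //; field; lra.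
Qed.

(** By the mean value theorem the remainder of the series is r c^K / (1 - c) for some c between 0
    and r. *)
Lemma log_series_bounds K r : 0 < r < 1 ->
  - ln (1 - r) - r ^ K / (1 - r) <= \sum_(1 <= k < K.+1) r ^ k / INR k <= - ln (1 - r).
Proof.
move=> [r0 r1].
pose f x := - ln (1 - x) - \sum_(1 <= k < K.+1) x ^ k / INR k.
have [|c [hc [c0 c1]]] := MVT_cor2 f (fun x => x ^ K / (1 - x)) 0 r r0.
  move=> c hc; apply/is_derive_Reals; apply: log_series_derive; lra.
have f0 : f 0 = 0.
  rewrite /f Rminus_0_r ln_1 big1_seq ?Rminus_0_r ?Ropp_0 // => k /andP[_].
  rewrite mem_iota1 => /andP[k0 _]; rewrite pow_i; last exact/ltP.
  by rewrite /Rdiv Rmult_0_l.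
rewrite f0 !Rminus_0_r /f in hc.
have cK : 0 <= c ^ K by apply: pow_le; lra.
have cr : c ^ K <= r ^ K by apply: pow_incr; lra.
have h1 : 0 <= c ^ K / (1 - c) by apply: Rdiv_le_0_compat; lra.
have h2 : c ^ K / (1 - c) <= r ^ K / (1 - r).
  apply: Rmult_le_compat => //; first by apply: Rlt_le; apply: Rinv_0_lt_compat; lra.
  by apply: Rinv_le_contravar; lra.
have h3 := Rmult_le_pos _ _ h1 (Rlt_le _ _ r0).
have h4 := Rmult_le_compat_l _ _ _ h1 (Rlt_le _ _ r1).
lra.
Qed.

(** * Harmonic numbers and Euler's constant *)

Lemma harmonicS n : harmonic n.+1 = harmonic n + / INR n.+1.
Proof. by []. Qed.

Lemma harmonic_diff K r :
  \sum_(1 <= k < K.+1) (harmonic k - harmonic k.-1) * r ^ k = \sum_(1 <= k < K.+1) r ^ k / INR k.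
Proof.
apply: Rsum_eq => // k; rewrite mem_iota1 => /andP[]; case: k => // k _ _ _.
by rewrite [k.+1.-1]/= harmonicS /Rdiv; ring.
Qed.

Lemma harmonic_ge_ln n : ln (INR n.+1) <= harmonic n.
Proof.
elim: n => [|n IH]; first by rewrite INR_1 ln_1 /=; lra.
rewrite harmonicS; have := ln_succ_le (ltn0Sn n); lra.
Qed.

Lemma euler_gamma_lim : is_lim_seq (fun n => harmonic n - ln (INR n)) euler_gamma.
Proof.
(* The shift avoids index 0, where [ln 0 = 0] makes the value 0 and breaks monotonicity: the
   sequence decreases only from its value 1 at n = 1. *)
have [l hl] : ex_finite_lim_seq (fun n => harmonic n.+1 - ln (INR n.+1)).
  apply: (ex_finite_lim_seq_decr _ 0) => n.
    rewrite (harmonicS n.+1); have := ln_succ_ge (ltn0Sn n); lra.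
  have := harmonic_ge_ln n.+1; have := ln_succ_ge (ltn0Sn n).
  have := Rinv_0_lt_compat _ (INR_pos (ltn0Sn n.+1)); lra.
have h : is_lim_seq (fun n => harmonic n - ln (INR n)) l by apply/is_lim_seq_incr_1.
by rewrite /euler_gamma (is_lim_seq_unique _ _ h).
Qed.

Section Gamma.
Variables (c K : R).
Hypothesis K0 : 0 <= K.
Hypothesis hc : forall n, (1 < n)%N ->
  Rabs (\sum_(1 <= p < n.+1 | prime p) euler_log p - ln (ln (INR n)) - c) <= K / ln (INR n).

(** Both terms are ln k plus a constant plus o(1), so [d] tends to [c - euler_gamma]; it remains to
    see that this limit is 0. *)
Let d k := euler_log_sum k - harmonic k.

Lemma euler_log_sum_asymp k : (1 < k)%N -> Rabs (euler_log_sum k - ln (INR k) - c) <= (K + 1) / (INR k - 1).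
Proof.
move=> k1; have k2 := INR_ltn k1; rewrite INR_1 in k2.
have [h1 h2] := ln_exp_floor (ltnW k1).
have := @hc (exp_floor k); rewrite -/(euler_log_sum k).
have -> : (1 < exp_floor k)%N by case: k k1 {h1 h2 k2} => // k _; exact: exp_floor_gt1.
move=> /(_ isT); set l := ln (INR (exp_floor k)) in h1 h2 * => h3.
have h4 : K / l <= K / (INR k - 1).
  by apply: Rmult_le_compat_l => //; apply: Rinv_le_contravar; lra.
have h5 : ln l <= ln (INR k) by apply: ln_le; lra.
have h6 := @ln_le_sub1 (INR k / l) ltac:(apply: Rdiv_lt_0_compat; lra).
rewrite ln_div in h6; [|lra|lra].
have h7 : INR k / l - 1 <= / (INR k - 1).
  have -> : / (INR k - 1) = INR k / (INR k - 1) - 1 by field; lra.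
  suff : INR k / l <= INR k / (INR k - 1) by lra.
  by apply: Rmult_le_compat_l; [lra | apply: Rinv_le_contravar; lra].
have -> : (K + 1) / (INR k - 1) = K / (INR k - 1) + / (INR k - 1) by field; lra.
by move: h3; split_Rabs; lra.
Qed.

Lemma diff_lim eps : 0 < eps -> exists N, forall k, (N <= k)%N -> Rabs (d k - (c - euler_gamma)) <= eps.
Proof.
move=> e0; have := euler_gamma_lim => /is_lim_seq_spec.
move=> /(_ (mkposreal _ (is_pos_div_2 (mkposreal _ e0)))) [N1 h1].
have [N2 h2] := INR_eventually_ge ((K + 1) / (eps / 2) + 1).
exists (maxn 2 (maxn N1 N2)) => k; rewrite !geq_max => /and3P[k2 kN1 kN2].
have := h1 k ltac:(apply/leP; exact: kN1); have := h2 k kN2; have := euler_log_sum_asymp k2.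
have k1 := INR_ltn k2; rewrite INR_1 in k1; rewrite /=.
move=> h3 h4 h5.
have h6 : (K + 1) / (INR k - 1) <= eps / 2.
  apply: (Rmult_le_reg_r (INR k - 1)); first lra.
  rewrite {1}/Rdiv Rmult_assoc Rinv_l ?Rmult_1_r; last lra.
  have : (K + 1) / (eps / 2) <= INR k - 1 by lra.
  move=> h; have := Rmult_le_compat_l (eps / 2) _ _ ltac:(lra) h.
  have -> : eps / 2 * ((K + 1) / (eps / 2)) = K + 1 by field; lra.
  lra.
by move: h3 h5; rewrite /d; split_Rabs; lra.
Qed.

Lemma exp_neg_le s : 0 <= s -> 1 - s <= exp (- s) <= 1.
Proof.
move=> s0; have := exp_ineq1_le (- s); split; first lra.
by rewrite -exp_0; case: s0 => h; [apply: Rlt_le; apply: exp_increasing; lra | rewrite -h Ropp_0; lra].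
Qed.

(** This is s ln (1/s) <= 2 sqrt s. Parametrizing by t = sqrt s lets all errors below be linear in
    t. *)
Lemma ln_inv_le_sqrt t : 0 < t -> - ln (t * t) * (t * t) <= 2 * t.
Proof.
move=> t0; rewrite ln_mult //.
have := @ln_ge_sub_inv t t0 => h.
have : - ln t * t <= 1 - t.
  have := Rmult_le_compat_r t _ _ (Rlt_le _ _ t0) h.
  rewrite Rmult_minus_distr_r Rinv_l; lra.
move=> h1; have := Rmult_le_compat_r t _ _ (Rlt_le _ _ t0) h1.
have := Rmult_lt_0_compat _ _ t0 t0; lra.
Qed.

(* The transforms of [euler_log] and of [1/k] both behave like [ln (1/s)], with [s = t^2]. *)
Lemma transforms_close t : 0 < t <= 1 -> exists N, forall K, (N <= K)%N ->
  Rabs (\sum_(1 <= k < K.+1) (d k - d k.-1) * exp (- (t * t)) ^ k) <= 10 * t.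
Proof.
move=> [t0 t1]; set s := t * t; have s0 : 0 < s by exact: Rmult_lt_0_compat.
have st : s <= t by have := Rmult_le_compat_l t _ _ (Rlt_le _ _ t0) t1; rewrite /s; lra.
set r := exp (- s); have [r1 r2] := exp_neg_le (Rlt_le _ _ s0).
have r0 : 0 < r by exact: exp_pos.
have r3 : r < 1 by rewrite /r -exp_0; apply: exp_increasing; lra.
rewrite -/r in r1 r2.
have [N1 h1] := zeta_log_lower s0.
have [N2 h2] : exists N, forall K, (N <= K)%N -> r ^ K / (1 - r) <= s.
  have [N hN] := INR_eventually_ge (- ln (s * (1 - r)) / s); exists N => k /hN hk.
  have sr : 0 < s * (1 - r) by apply: Rmult_lt_0_compat; lra.
  apply: (Rmult_le_reg_r (1 - r)); first lra.
  rewrite /Rdiv Rmult_assoc Rinv_l ?Rmult_1_r; last lra.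
  rewrite /r exp_pow -(exp_ln (s * (1 - r))) //.
  have h := Rmult_le_compat_l s _ _ (Rlt_le _ _ s0) hk.
  have e : s * (- ln (s * (1 - r)) / s) = - ln (s * (1 - r)) by field; lra.
  rewrite e in h.
  have : - s * INR k <= ln (s * (1 - r)) by lra.
  by case=> h3; [apply: Rlt_le; apply: exp_increasing | rewrite h3; apply: Rle_refl].
exists (maxn N1 N2) => k; rewrite geq_max => /andP[kN1 kN2].
have kE : (N1 <= exp_floor k)%N.
  apply: (leq_trans kN1); rewrite -ltnS; apply/ltP; apply: INR_lt; rewrite S_INR.
  by have [_ h] := exp_floorP k; have := exp_ineq1_le (INR k); lra.
have -> : \sum_(1 <= k < k.+1) (d k - d k.-1) * r ^ k =
  \sum_(1 <= k < k.+1) (euler_log_sum k - euler_log_sum k.-1) * r ^ k - \sum_(1 <= k < k.+1) r ^ k / INR k.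
  by rewrite -harmonic_diff -Rsum_sub; apply: eq_bigr => i _; rewrite /d; ring.
have [f1 f2] := euler_log_sum_transform k s0; rewrite -/r in f1 f2.
have [g1 g2] := euler_log_npow_sum (exp_floor k) s0.
have [l1 l2] := log_series_bounds k (conj r0 r3).
have h3 := h2 k kN2; have h4 := h1 _ kE; have h5 := zeta_log_upper (exp_floor k) s0.
set F := \sum_(1 <= k0 < k.+1) (euler_log_sum k0 - euler_log_sum k0.-1) * r ^ k0 in f1 f2 *.
set L := \sum_(1 <= k0 < k.+1) r ^ k0 / INR k0 in l1 l2 *.
set P := \sum_(1 <= p < (exp_floor k).+1 | prime p) npow s p * euler_log p in f1 f2 g1 g2.
have u1 : ln (1 - r) <= ln s by apply: ln_le; lra.
have u2 : ln s - s <= ln (1 - r).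
  have : s * r <= 1 - r.
    have := exp_ineq1_le s; have : exp s * r = 1 by rewrite /r -exp_plus Rplus_opp_r exp_0.
    move=> e h; have := Rmult_le_compat_r r _ _ (Rlt_le _ _ r0) h; lra.
  move=> h; have := ln_le _ _ (Rmult_lt_0_compat _ _ s0 r0) h.
  by rewrite ln_mult // /r ln_exp; lra.
have u3 : ln (1 + / s) <= s - ln s.
  have -> : 1 + / s = (1 + s) * / s by field; lra.
  rewrite ln_mult ?ln_Rinv; [|lra|lra|exact: Rinv_0_lt_compat].
  have := @ln_le_sub1 (1 + s); lra.
have u4 : - ln s * s <= 2 * t by exact: ln_inv_le_sqrt.
have up : F - L <= 5 * t by lra.
(* Undoing the factor exp s from the rounding of ln p loses (1 - r) ln (1/s) <= s ln (1/s), the only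
   error that is not O(s). *)
have lo : - (5 * t) <= F - L.
  have : r * (- ln s - s) <= F.
    have : exp s * r = 1 by rewrite /r -exp_plus Rplus_opp_r exp_0.
    move=> e; have : - ln s - s <= exp s * F by lra.
    move=> h; have := Rmult_le_compat_l r _ _ (Rlt_le _ _ r0) h.
    by rewrite -Rmult_assoc (Rmult_comm r (exp s)) e; lra.
  have ls : 0 <= - ln s by have := @ln_le s 1 s0 ltac:(lra); rewrite ln_1; lra.
  have := Rmult_le_compat_r (- ln s) _ _ ls r1.
  have := Rmult_le_compat_r s _ _ (Rlt_le _ _ s0) r2; lra.
by split_Rabs; lra.
Qed.

Lemma mertens_constant : c = euler_gamma.
Proof.
apply: Rminus_diag_uniq; set dl := c - euler_gamma.
case: (Req_dec dl 0) => // dn0; exfalso.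
have dp : 0 < Rabs dl by exact: Rabs_pos_lt.
have [N hN] := @diff_lim (Rabs dl / 4) ltac:(lra).
set M := \sum_(0 <= k < N) Rabs (d k - dl).
have M0 : 0 <= M by apply: Rsum_ge0 => k _ _; exact: Rabs_pos.
(* Chosen so that 10 t + t M <= |dl|/4: adding the tail error |dl|/4 yields |dl| <= |dl|/2, a
   contradiction. *)
set t := Rmin 1 (Rabs dl / 4 / (10 + M)).
have q0 : 0 < Rabs dl / 4 / (10 + M) by apply: Rdiv_lt_0_compat; lra.
have t0 : 0 < t by apply: Rmin_glb_lt; lra.
have t1 : t <= 1 by exact: Rmin_l.
have t2 : t * (10 + M) <= Rabs dl / 4.
  have := Rmult_le_compat_r (10 + M) _ _ ltac:(lra) (Rmin_r 1 (Rabs dl / 4 / (10 + M))).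
  by rewrite -/t /(Rdiv (_ / 4)) Rmult_assoc Rinv_l; lra.
have [N2 h2] := transforms_close (conj t0 t1).
have h3 := h2 (maxn N N2) (leq_maxr _ _).
have s0 := Rmult_lt_0_compat _ _ t0 t0.
have r3 : exp (- (t * t)) < 1 by rewrite -exp_0; apply: exp_increasing; lra.
have h4 := @abel_finite_bound d dl (Rabs dl / 4) _ N (maxn N N2) (conj (exp_pos (- (t * t))) r3) (leq_maxl _ _) hN.
rewrite -/M (_ : d 0%N = 0) in h4; last by rewrite /d euler_log_sum0 /=; lra.
have [r1 _] := exp_neg_le (Rlt_le _ _ s0).
have h5 := Rmult_le_compat_r M _ _ M0 (_ : 1 - exp (- (t * t)) <= t * t).
have h6 := h5 ltac:(lra).
have h7 := Rmult_le_compat_r M _ _ M0 (_ : t * t <= t).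
have h8 := h7 ltac:(have := Rmult_le_compat_l t _ _ (Rlt_le _ _ t0) t1; lra).
move: h3 h4; set S := \sum_(1 <= k < _.+1) (d k - d k.-1) * exp (- (t * t)) ^ k => h3 h4.
by move: dp h3 h4 t2 h6 h8; split_Rabs; lra.
Qed.
End Gamma.

Lemma mertens3 : exists K, 0 <= K /\ forall n, (1 < n)%N ->
  Rabs (\sum_(1 <= p < n.+1 | prime p) euler_log p - ln (ln (INR n)) - euler_gamma) <= K / ln (INR n).
Proof.
have [c [K [K0 h]]] := mertens3_const.
by exists K; rewrite -(mertens_constant K0 h).
Qed.

(** * Sieve bounds *)

Definition coprime_count x L := coprime_sum (fun=> 1) x L.

Lemma coprime_count_bounds x L : 0 <= coprime_count x L <= INR x.
Proof.
split; first by apply: coprime_sum_ge0 => *; lra.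
rewrite -[X in _ <= X]Rmult_1_r -Rsum_count; apply: Rsum_leP => // *; lra.
Qed.

Definition sieve_density (L : seq nat) := \prod_(p <- L) (1 - / INR p).

Lemma sieve_density_bounds L : all prime L -> 0 <= sieve_density L <= 1.
Proof.
rewrite /sieve_density; elim: L => [|p L IH] /=; first by rewrite big_nil; lra.
move=> /andP[pp /IH h]; rewrite big_cons.
have := INR_ltn (prime_gt1 pp); rewrite INR_1 => p1.
have i1 : / INR p < 1 by rewrite -Rinv_1; apply: Rinv_lt_contravar; lra.
have i0 : 0 < / INR p by apply: Rinv_0_lt_compat; lra.
split; first by apply: Rmult_le_pos; lra.
rewrite -[X in _ <= X]Rmult_1_r; apply: Rmult_le_compat; lra.
Qed.

(* The Legendre expansion is cut after [k] prime factors, where the trivial bound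
   [0 <= coprime_count x L <= x] takes over: no signs of Bonferroni type are needed. *)
Lemma brun_sieve lam k L x X : 0 < lam -> all prime L -> uniq L ->
  INR x <= X < INR x + 1 ->
  Rabs (coprime_count x L - X * sieve_density L) <=
  INR (1 + size L) ^ k + X * (/ lam) ^ k * \prod_(p <- L) (1 + lam / INR p).
Proof.
move=> lam0; have il := Rinv_0_lt_compat _ lam0.
elim: L k x X => [|p L IH] k x X.
  move=> _ _ hX; rewrite /coprime_count /coprime_sum /sieve_density !big_nil /= Rsum_count INR_1 pow1.
  have : 0 <= X * (/ lam) ^ k.
    by apply: Rmult_le_pos; [have := pos_INR x; lra | apply: pow_le; lra].
  split_Rabs; lra.
rewrite [all _ _]/= [uniq _]/= => /andP[pp aL] /andP[pL uL] hX.
have X0 : 0 <= X by have := pos_INR x; lra.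
have p0 := INR_pos (prime_gt0 pp).
have prod_ge1 (l : seq nat) : all prime l -> 1 <= \prod_(p <- l) (1 + lam / INR p).
  elim: l => [|q l IHl] /=; first by rewrite big_nil; lra.
  move=> /andP[qp /IHl h]; rewrite big_cons.
  have : 0 <= lam / INR q by apply: Rdiv_le_0_compat; [lra | exact: INR_pos (prime_gt0 qp)].
  by move=> h1; have := Rmult_le_compat_l _ _ _ h1 h; lra.
(* When no expansion step is left, both the count and its main term lie in [0, X], and the product
   on the right is at least 1. *)
case: k => [|k].
  have aL' : all prime (p :: L) by rewrite /= pp.
  have [h1 h2] := coprime_count_bounds x (p :: L).
  have [h3 h4] := sieve_density_bounds aL'.
  have h5 := Rmult_le_pos _ _ X0 h3.
  have h6 := Rmult_le_compat_l _ _ _ X0 h4.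
  have h7 := Rmult_le_compat_l _ _ _ X0 (prod_ge1 _ aL').
  by rewrite !pow_O; split_Rabs; lra.
have [d1 d2] := INR_divn x (prime_gt0 pp).
have hX' : INR (x %/ p) <= X / INR p < INR (x %/ p) + 1.
  split.
    apply: (Rle_trans _ _ _ d1); apply: Rmult_le_compat_r; last lra.
    by apply: Rlt_le; exact: Rinv_0_lt_compat.
  apply: (Rmult_lt_reg_r (INR p)) => //.
  rewrite /Rdiv Rmult_assoc Rinv_l ?Rmult_1_r; last lra.
  have : INR x.+1 <= INR ((x %/ p).+1 * p)%N.
    by apply: INR_leq; exact: ltn_ceil (prime_gt0 pp).
  rewrite mulnINR !S_INR; lra.
have h1 := IH k.+1 x X aL uL hX.
have h2 := IH k (x %/ p)%N (X / INR p) aL uL hX'.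
rewrite /coprime_count coprime_sum_cons // -/(coprime_count x L) -/(coprime_count (x %/ p) L); last first.
  by move=> *; lra.
rewrite /sieve_density !big_cons -/(sieve_density L) [size (_ :: _)]/=.
move: h1 h2; set A := coprime_count x L; set A' := coprime_count _ L; set D := sieve_density L.
set P := \prod_(p <- L) (1 + lam / INR p); set m := INR (1 + size L).
move=> h1 h2.
have m0 : 0 <= m by exact: pos_INR.
(* The rounding errors obey the recursion for the number of subsets with a bounded number of
   elements. *)
have hm : m ^ k.+1 + m ^ k <= INR (1 + (size L).+1) ^ k.+1.
  have -> : INR (1 + (size L).+1) = m + 1 by rewrite addnS S_INR.
  have : m ^ k <= (m + 1) ^ k by apply: pow_incr; lra.
  have -> : m ^ k.+1 + m ^ k = (m + 1) * m ^ k by rewrite /=; ring.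
  by move=> h; rewrite [X in _ <= X]/=; apply: Rmult_le_compat_l; lra.
have e1 : A - 1 * A' - X * ((1 - / INR p) * D) = (A - X * D) - (A' - X / INR p * D) by field; lra.
(* Rankin's weight: the branch divided by p has one step fewer, and lam/p times lam^(-(k+1)) is
   exactly lam^(-k)/p. *)
have e2 : X * (/ lam) ^ k.+1 * ((1 + lam / INR p) * P) =
   X * (/ lam) ^ k.+1 * P + X / INR p * (/ lam) ^ k * P by rewrite /=; field; lra.
rewrite e1 e2; split_Rabs; lra.
Qed.

Lemma hyperbola_swap n (P : pred nat) (F : nat -> nat -> R) :
  \sum_(1 <= d < n.+1) \sum_(1 <= e < (n %/ d).+1 | P e) F d e =
  \sum_(1 <= e < n.+1 | P e) \sum_(1 <= d < (n %/ e).+1) F d e.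
Proof.
have widen d (Q : pred nat) (G : nat -> R) : (0 < d)%N ->
    \sum_(1 <= e < (n %/ d).+1 | Q e) G e = \sum_(1 <= e < n.+1 | Q e && (e * d <= n)%N) G e.
  move=> d0; rewrite (big_nat_widen _ _ n.+1); last by rewrite ltnS leq_div.
  by apply: eq_bigl => e; rewrite ltnS leq_divRL.
transitivity (\sum_(1 <= d < n.+1) \sum_(1 <= e < n.+1 | P e && (e * d <= n)%N) F d e).
  by apply: Rsum_eq => // d; rewrite mem_iota1 => /andP[d0 _] _; exact: widen.
rewrite (exchange_big_dep P) /=; last by move=> d e _ /andP[].
apply: Rsum_eq => // e; rewrite mem_iota1 => /andP[e0 _] Pe.
rewrite (widen e xpredT (fun d => F d e)) //; apply: eq_bigl => d.
by rewrite Pe mulnC.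
Qed.

Lemma harmonicE n : harmonic n = \sum_(1 <= i < n.+1) / INR i.
Proof.
elim: n => [|n IH]; first by rewrite big_geq.
by rewrite [RHS]big_nat_recr //= -IH.
Qed.

Lemma harmonic_le_ln n : (0 < n)%N -> harmonic n <= 1 + ln (INR n).
Proof.
case: n => // n _; elim: n => [|n IH].
  by rewrite harmonicS INR_1 ln_1 Rinv_1 /=; lra.
rewrite harmonicS; have := ln_succ_ge (ltn0Sn n); lra.
Qed.

(** * Upper bounds for integers without small prime factors *)

Definition rough y (m : nat) := all (fun p => ~~ (p %| m)) (primes_upto y).

Lemma roughP y m : reflect (forall p, prime p -> (p <= y)%N -> ~~ (p %| m)) (rough y m).
Proof.
apply: (iffP allP) => h p; first by move=> pp py; apply: h; rewrite mem_primes_upto pp.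
by rewrite mem_primes_upto => /andP[]; exact: h.
Qed.

Lemma rough_dvd y d m : d %| m -> rough y m -> rough y d.
Proof.
move=> dm /roughP h; apply/roughP => p pp py; apply: contra (h p pp py) => pd.
exact: dvdn_trans pd dm.
Qed.

Lemma rough_coprime y d m : (0 < d <= y)%N -> rough y m -> coprime d m.
Proof.
move=> /andP[d0 dy] /roughP h; apply/negPn/negP => nc.
have g0 : (0 < gcdn d m)%N by rewrite gcdn_gt0 d0.
have g1 : (1 < gcdn d m)%N by rewrite ltn_neqAle eq_sym -/(coprime d m) nc.
have pp := pdiv_prime g1; have pg := pdiv_dvd (gcdn d m).
have pd := dvdn_trans pg (dvdn_gcdl d m); have pm := dvdn_trans pg (dvdn_gcdr d m).
by move: (h _ pp (leq_trans (dvdn_leq d0 pd) dy)); rewrite pm.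
Qed.

(* Every [n] has at most one factorization [n = a m] with [a <= y] and [m] free of primes [<= y]. *)
Lemma harmonic_mul_rough x y :
  harmonic y * \sum_(1 <= m < x.+1 | rough y m) / INR m <= harmonic (x * y).
Proof.
rewrite !harmonicE.
pose ok n d := [&& (d <= y)%N, (n %/ d <= x)%N & rough y (n %/ d)].
pose F n d := if ok n d then / INR n else 0.
have F0 n d : (0 < n)%N -> 0 <= F n d.
  move=> n0; rewrite /F; case: ifP => _; last lra.
  by apply: Rlt_le; apply: Rinv_0_lt_compat; exact: INR_pos.
apply: (Rle_trans _ (\sum_(1 <= n < (x * y).+1) \sum_(1 <= d < n.+1 | d %| n) F n d)); last first.
  apply: Rsum_le => n; rewrite mem_iota1 => /andP[n0 _] _.
  rewrite /F -big_mkcondr /=; apply: Rsum_at_most_one; first exact: iota_uniq.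
    by apply: Rlt_le; apply: Rinv_0_lt_compat; exact: INR_pos.
  (* As d <= y is coprime to the rough cofactor n/e, Gauss' lemma gives d | e; uniqueness follows by
     symmetry. *)
  have dv d e : (0 < d)%N -> d %| n -> ok n d -> e %| n -> ok n e -> d %| e.
    move=> d0 dn /and3P[dy _ _] en /and3P[_ _ re].
    have c : coprime d (n %/ e) by apply: rough_coprime re; rewrite d0.
    by rewrite -(Gauss_dvdr e c) divnK.
  move=> d e; rewrite !mem_iota1 => /andP[d0 _] /andP[e0 _] /andP[dn okd] /andP[en oke].
  by apply/eqP; rewrite eqn_dvd (dv d e) ?(dv e d).
rewrite (Rsum_divisors_swap _ xpredT F).
case: (posnP x) => [->|x0].
  rewrite [X in _ * X]big_geq // Rmult_0_r; apply: Rsum_ge0 => d; rewrite mem_iota1 => /andP[d0 _] _.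
  by apply: Rsum_ge0 => m; rewrite mem_iota1 => /andP[m0 _] _; apply: F0; rewrite muln_gt0 d0.
apply: (Rle_trans _ (\sum_(1 <= d < y.+1) \sum_(1 <= m < ((x * y) %/ d).+1) F (d * m)%N d)); last first.
  apply: Rsum_extend; first by rewrite ltnS leq_pmull.
  move=> d /andP[d0 _] _.
  by apply: Rsum_ge0 => m; rewrite mem_iota1 => /andP[m0 _] _; apply: F0; rewrite muln_gt0 d0.
rewrite -Rsum_mulr; apply: Rsum_le => d; rewrite mem_iota1 => /andP[d0 dy] _.
have xd : (x <= (x * y) %/ d)%N by rewrite leq_divRL // leq_mul2l dy orbT.
apply: (Rle_trans _ (\sum_(1 <= m < x.+1) F (d * m)%N d)); last first.
  apply: Rsum_extend; first by rewrite ltnS.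
  by move=> m /andP[m0 _] _; apply: F0; rewrite muln_gt0 d0.
rewrite -Rsum_mull big_mkcond; apply: Rsum_le => m; rewrite mem_iota1 => /andP[m0 mx] _.
have hF := @F0 (d * m)%N d; case: ifP => rm; last by apply: hF; rewrite muln_gt0 d0.
rewrite /F /ok mulKn // dy mx rm /= mulnINR Rinv_mult; lra.
Qed.

Lemma ln2_ge : 1 / 2 <= ln 2.
Proof. have := @ln_ge_sub_inv 2 ltac:(lra); lra. Qed.

(** Weight the count by ln x = ln (x/m) + ln m. The first part is at most x times the sum S of 1/m
    over rough m; the second is at most 4 x S, expanding ln m by von Mangoldt and using Chebyshev.
    The bound on S comes from [harmonic_mul_rough], and 1 + 2 ln x <= 4 ln x turns the 5 into 20. *)
Lemma rough_count x y : (0 < y <= x)%N -> (1 < x)%N ->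
  coprime_count x (primes_upto y) <= 20 * INR x / ln (INR y.+1).
Proof.
move=> /andP[y0 yx] x1; have x0 : (0 < x)%N by lia.
have xp := INR_pos x0.
set A := coprime_count _ _; set S := \sum_(1 <= m < x.+1 | rough y m) / INR m.
have lx : 1 / 2 <= ln (INR x).
  apply: (Rle_trans _ _ _ ln2_ge); apply: ln_le; first lra.
  by rewrite -INR_2; exact: INR_leq.
have ly : 0 < ln (INR y.+1) by apply: ln_INR_gt0.
have h1 : ln (INR x) * A <= 5 * INR x * S.
  have e : ln (INR x) * A = \sum_(1 <= m < x.+1 | rough y m) (ln (INR x) - ln (INR m)) +
      \sum_(1 <= m < x.+1 | rough y m) ln (INR m).
    rewrite -Rsum_add /A /coprime_count /coprime_sum -Rsum_mull.
    by apply: eq_bigr => i _; ring.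
  have e1 : \sum_(1 <= m < x.+1 | rough y m) (ln (INR x) - ln (INR m)) <= INR x * S.
    rewrite /S -Rsum_mull; apply: Rsum_le => m; rewrite mem_iota1 => /andP[m0 _] _.
    have mp := INR_pos m0; rewrite -ln_div //.
    have := @ln_le_sub1 (INR x / INR m) (Rdiv_lt_0_compat _ _ xp mp); rewrite /Rdiv; lra.
  have e2 : \sum_(1 <= m < x.+1 | rough y m) ln (INR m) <= 4 * INR x * S.
    rewrite (@Rsum_eq _ _ _ (rough y) _
      (fun i => \sum_(1 <= d < i.+1 | d %| i) mangoldt d)) //; last first.
      by move=> i; rewrite mem_iota1 => /andP[i0 _] _; exact: ln_mangoldt.
    rewrite (Rsum_divisors_swap x (rough y) (fun i d => mangoldt d)).
    apply: (Rle_trans _ (\sum_(1 <= d < x.+1) \sum_(1 <= m < (x %/ d).+1 | rough y m) mangoldt d)).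
      apply: Rsum_le => d _ _; apply: Rsum_leP; last by move=> *; exact: mangoldt_ge0.
      by move=> m _; apply: rough_dvd; exact: dvdn_mull.
    rewrite (hyperbola_swap x (rough y) (fun d e => mangoldt d)) /S -Rsum_mull.
    apply: Rsum_le => m; rewrite mem_iota1 => /andP[m0 _] _.
    rewrite -/(psi (x %/ m)); have := psi_le (x %/ m); have [h _] := INR_divn x m0.
    rewrite /Rdiv in h; lra.
  lra.
have h2 : ln (INR y.+1) * S <= 1 + 2 * ln (INR x).
  have S0 : 0 <= S.
    apply: Rsum_ge0 => m; rewrite mem_iota1 => /andP[m0 _] _.
    by apply: Rlt_le; apply: Rinv_0_lt_compat; exact: INR_pos.
  have h3 := Rmult_le_compat_r _ _ _ S0 (harmonic_ge_ln y).
  have h4 := harmonic_mul_rough x y; rewrite -/S in h4.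
  have h5 : harmonic (x * y) <= 1 + ln (INR (x * y)) by apply: harmonic_le_ln; rewrite muln_gt0 x0.
  rewrite mulnINR ln_mult // in h5; last exact: INR_pos.
  have : ln (INR y) <= ln (INR x) by apply: ln_le; [exact: INR_pos | exact: INR_leq].
  lra.
apply: (Rmult_le_reg_l (ln (INR x))); first lra.
apply: (Rle_trans _ _ _ h1).
apply: (Rmult_le_reg_l (ln (INR y.+1))) => //.
have -> : ln (INR y.+1) * (ln (INR x) * (20 * INR x / ln (INR y.+1))) = 5 * INR x * (4 * ln (INR x)) by field; lra.
have -> : ln (INR y.+1) * (5 * INR x * S) = 5 * INR x * (ln (INR y.+1) * S) by ring.
by apply: Rmult_le_compat_l; lra.
Qed.

(** Write ln x = ln (x/p) + ln p: summing ln (x/i) over all i <= x gives at most x by Stirling, and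
    [psi x <= 4 x] bounds the rest. *)
Lemma prime_count_le x : (1 < x)%N -> \sum_(1 <= p < x.+1 | prime p) 1 <= 5 * INR x / ln (INR x).
Proof.
move=> x1; have l0 := ln_INR_gt0 x1; have x0 : (0 < x)%N by lia.
apply: (Rmult_le_reg_l (ln (INR x))) => //.
have -> : ln (INR x) * (5 * INR x / ln (INR x)) = 5 * INR x by field; lra.
rewrite -Rsum_mull.
rewrite (eq_bigr (fun p => (ln (INR x) - ln (INR p)) + ln (INR p))); last by move=> i _; ring.
rewrite Rsum_add.
have h1 : \sum_(1 <= p < x.+1 | prime p) (ln (INR x) - ln (INR p)) <= INR x * ln (INR x) - lnfact x.
  rewrite /lnfact -Rsum_count -Rsum_sub; apply: Rsum_leP => // i; rewrite mem_iota1 => /andP[i0 ix] _.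
  suff : ln (INR i) <= ln (INR x) by lra.
  by apply: ln_le; [exact: INR_pos | exact: INR_leq].
have h2 : \sum_(1 <= p < x.+1 | prime p) ln (INR p) <= psi x.
  rewrite (eq_bigr mangoldt); last by move=> p pp; rewrite mangoldt_prime.
  by apply: Rsum_leP => // *; exact: mangoldt_ge0.
apply: (Rle_trans _ _ _ (Rplus_le_compat _ _ _ _ h1 h2)).
by have := lnfact_ge x; have := psi_le x; lra.
Qed.

(** Partial summation of ln p / p against 1/(ln p)^2: since A(n) = O(ln n), the increments are at
    most a constant times the differences of 1/ln n, which telescope. *)
Lemma sum_inv_p_ln_bounded : exists C, 0 <= C /\ forall n,
  \sum_(1 <= p < n.+1 | prime p) / (INR p * ln (INR p)) <= C.
Proof.
pose a p := if prime p then ln (INR p) / INR p else 0.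
pose A n := \sum_(1 <= p < n.+1) a p.
pose S n := \sum_(1 <= p < n.+1) a p / (ln (INR p) * ln (INR p)).
(* ln n + 6 <= 13 ln n because ln n >= 1/2. *)
have hA n : (1 < n)%N -> 0 <= A n <= 13 * ln (INR n).
  move=> n1; have := @mertens1 n ltac:(lia); rewrite big_mkcond -/(A n).
  have : ln 2 <= ln (INR n) by apply: ln_le; [lra | rewrite -INR_2; exact: INR_leq].
  have A0 : 0 <= A n.
    apply: Rsum_ge0 => p; rewrite mem_iota1 /a => /andP[p0 _] _; case: ifP => _; last lra.
    by apply: Rdiv_le_0_compat; [exact: ln_INR_ge0 | exact: INR_pos].
  by have := ln2_ge; split_Rabs; lra.
have key n : S n.+2 - A n.+2 / (ln (INR n.+2) * ln (INR n.+2)) <= 26 * (/ ln 2 - / ln (INR n.+2)).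
  elim: n => [|n IH].
    rewrite /S /A !(big_nat_recr 2) // !big_nat1 /a /= INR_2; have := ln2_ge => h.
    by rewrite [0 / _]/Rdiv Rmult_0_l; right; field; lra.
  rewrite /S /A !(big_nat_recr n.+3 1) // -/(S n.+2) -/(A n.+2) /=.
  have u0 := @ln_INR_gt0 n.+2 isT; have v0 := @ln_INR_gt0 n.+3 isT.
  have uv : ln (INR n.+2) <= ln (INR n.+3) by apply: ln_le; [exact: INR_pos | exact: INR_leq].
  have [A0 A1] := hA n.+2 isT.
  set u := ln (INR n.+2) in u0 uv IH A1; set v := ln (INR n.+3) in v0 uv *.
  set A' := A n.+2 in A0 A1 IH *; set S' := S n.+2 in IH *.
  have iuv : / v <= / u by apply: Rinv_le_contravar.
  have iv := Rinv_0_lt_compat _ v0.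
  have h : A' * (/ u * / u - / v * / v) <= 26 * (/ u - / v).
    have h1 : 0 <= / u * / u - / v * / v.
      by have := Rmult_le_compat _ _ _ _ (Rlt_le _ _ iv) (Rlt_le _ _ iv) iuv iuv; lra.
    have h2 := Rmult_le_compat_r _ _ _ h1 A1.
    have h3 : 13 * u * (/ u * / u - / v * / v) = 13 * (1 + u * / v) * (/ u - / v) by field; lra.
    have h4 : u * / v <= 1 by have := Rmult_le_compat_r _ _ _ (Rlt_le _ _ iv) uv; rewrite Rinv_r; lra.
    have := Rmult_le_compat_r (/ u - / v) _ _ ltac:(lra) h4; lra.
  have e : S' + a n.+3 / (v * v) - (A' + a n.+3) / (v * v) =
    S' - A' / (u * u) + A' * (/ u * / u - / v * / v) by field; lra.
  rewrite e; lra.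
have l2 := ln2_ge; have il2 : / ln 2 <= 2.
  by have := Rinv_le_contravar (1 / 2) (ln 2) ltac:(lra) l2; lra.
exists 100; split; first lra.
move=> n.
have -> : \sum_(1 <= p < n.+1 | prime p) / (INR p * ln (INR p)) = S n.
  rewrite /S big_mkcond; apply: Rsum_eq => // p _ _; rewrite /a; case: ifP => pp; last by rewrite /Rdiv Rmult_0_l.
  by have := ln_INR_gt0 (prime_gt1 pp); have := INR_pos (prime_gt0 pp) => *; field; lra.
case: n => [|[|n]].
- by rewrite /S big_geq //; lra.
- by rewrite /S big_nat1 /a /= /Rdiv Rmult_0_l; lra.
have := key n; have [A0 A1] := hA n.+2 isT.
have u0 := @ln_INR_gt0 n.+2 isT; have iu := Rinv_0_lt_compat _ u0.
have ul : ln 2 <= ln (INR n.+2) by apply: ln_le; [lra | rewrite -INR_2; exact: INR_leq].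
have iul := Rinv_le_contravar (ln 2) _ ltac:(lra) ul.
have h : A n.+2 / (ln (INR n.+2) * ln (INR n.+2)) <= 13 * / ln (INR n.+2).
  have -> : 13 * / ln (INR n.+2) = 13 * ln (INR n.+2) / (ln (INR n.+2) * ln (INR n.+2)) by field; lra.
  by apply: Rmult_le_compat_r => //; apply: Rlt_le; apply: Rinv_0_lt_compat; exact: Rmult_lt_0_compat.
lra.
Qed.

(** * The least prime factor *)

Lemma exp_sub1_abs B x : Rabs x <= B -> Rabs (exp x - 1) <= Rabs x * exp B.
Proof.
move=> xB; have B0 : 0 <= B by have := Rabs_pos x; lra.
have e1 : 1 <= exp B by have := exp_ineq1_le B; lra.
have exB : exp x <= exp B by apply: exp_le; move: xB; split_Rabs; lra.
have h1 := exp_ineq1_le x; have h2 := exp_ineq1_le (- x).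
have h3 : exp x - 1 <= x * exp x.
  have := Rmult_le_compat_l _ _ _ (Rlt_le _ _ (exp_pos x)) h2.
  by rewrite -exp_plus Rplus_opp_r exp_0; lra.
case: (Rle_dec 0 x) => x0.
  rewrite !Rabs_pos_eq //; last lra.
  by have := Rmult_le_compat_l _ _ _ x0 exB; lra.
rewrite (Rabs_left x); last lra.
have h4 : exp x <= 1 by rewrite -exp_0; apply: exp_le; lra.
rewrite Rabs_left1; last lra.
by have := Rmult_le_compat_l (- x) _ _ ltac:(lra) e1; lra.
Qed.

Lemma primes_uptoS p : prime p -> \sum_(1 <= q < p.+1 | prime q) euler_log q =
  \sum_(q <- primes_upto p.-1) euler_log q + euler_log p.
Proof.
case: p => // p pp; rewrite /primes_upto big_filter [LHS]big_mkcond big_nat_recr //=.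
by rewrite pp -big_mkcond.
Qed.

Lemma sieve_density_exp L : all prime L ->
  sieve_density L = exp (- \sum_(q <- L) euler_log q).
Proof.
move=> aL; rewrite -Rsum_opp -Rprod_exp /sieve_density [LHS]big_seq [RHS]big_seq.
apply: eq_bigr => q qL; have qp := allP aL q qL.
rewrite /euler_log Ropp_involutive exp_ln //.
have := INR_ltn (prime_gt1 qp); rewrite INR_1 => q1.
have : / INR q < 1 by rewrite -Rinv_1; apply: Rinv_lt_contravar; lra.
lra.
Qed.

Lemma ln_prime_ge p : prime p -> 1 / 2 <= ln (INR p).
Proof.
move=> pp; apply: (Rle_trans _ _ _ ln2_ge); apply: ln_le; first lra.
by rewrite -INR_2; apply: INR_leq; exact: prime_gt1.
Qed.

(** Exponentiated Mertens' third theorem. The product runs over primes below p only; leaving out p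
    costs [euler_log p <= 2/p <= 2/ln p], the 2 in K + 2. *)
Lemma sieve_density_asymp : exists C, 0 <= C /\ forall p, prime p ->
  Rabs (sieve_density (primes_upto p.-1) * ln (INR p) - exp (- euler_gamma)) <= C / ln (INR p).
Proof.
have [K [K0 hK]] := mertens3.
set B := 2 * (K + 2).
exists (exp (- euler_gamma) * ((K + 2) * exp B)); split.
  by apply: Rmult_le_pos; [exact: Rlt_le (exp_pos _) | apply: Rmult_le_pos; [lra | exact: Rlt_le (exp_pos _)]].
move=> p pp; have lp := ln_prime_ge pp; have p0 := INR_pos (prime_gt0 pp).
have := hK p (prime_gt1 pp); rewrite (primes_uptoS pp) sieve_density_exp ?primes_upto_prime //.
set S := \sum_(q <- _) euler_log q; set l := ln (INR p) in lp *; move=> h.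
have [b1 b2] := euler_log_bounds (prime_gt1 pp).
have p2 := INR_leq (prime_gt1 pp); rewrite INR_2 in p2.
have b3 : / (INR p * (INR p - 1)) <= / INR p.
  by apply: Rinv_le_contravar => //; have := Rmult_le_compat_l (INR p) 2 (INR p) ltac:(lra) p2; lra.
have b4 : / INR p <= / l.
  by apply: Rinv_le_contravar; [lra | have := ln_le_sub1 p0; rewrite -/l; lra].
have ip := Rinv_0_lt_compat _ p0; have il : 0 < / l by apply: Rinv_0_lt_compat; lra.
set eta := - (S - ln l - euler_gamma).
have he : Rabs eta <= (K + 2) / l.
  rewrite /eta Rabs_Ropp; rewrite /Rdiv in h *.
  by move: h; split_Rabs; lra.
have heB : (K + 2) / l <= B.
  rewrite /B Rmult_comm; apply: Rmult_le_compat_l; first lra.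
  have := Rinv_le_contravar (1/2) l ltac:(lra) lp; lra.
have -> : exp (- S) * l - exp (- euler_gamma) = exp (- euler_gamma) * (exp eta - 1).
  rewrite -[X in _ * X - _](exp_ln l); last lra.
  by rewrite Rmult_minus_distr_l -!exp_plus Rmult_1_r; congr (exp _ - _); rewrite /eta; ring.
rewrite Rabs_mult (Rabs_pos_eq (exp _)); last exact: Rlt_le (exp_pos _).
rewrite /Rdiv Rmult_assoc; apply: Rmult_le_compat_l; first exact: Rlt_le (exp_pos _).
apply: (Rle_trans _ _ _ (exp_sub1_abs (Rle_trans _ _ _ he heB))).
by have := Rmult_le_compat_r _ _ _ (Rlt_le _ _ (exp_pos B)) he; rewrite /Rdiv; lra.
Qed.

Definition log_pdiv_sum N := \sum_(1 <= n < N.+1) ln (INR (pdiv n)).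

Lemma pdiv_eq_rough p m : prime p -> (0 < m)%N -> (pdiv (p * m) == p) = rough p.-1 m.
Proof.
move=> pp m0; have p1 := prime_gt1 pp.
have pm1 : (1 < p * m)%N by rewrite (leq_trans p1) // leq_pmulr.
apply/eqP/roughP => [pE q qp qlt|h].
  apply/negP => qm; have := pdiv_min_dvd (prime_gt1 qp) (dvdn_mull p qm).
  rewrite pE; lia.
have qp := pdiv_prime pm1.
have le1 : (pdiv (p * m) <= p)%N by apply: pdiv_min_dvd => //; exact: dvdn_mulr.
have := pdiv_dvd (p * m); rewrite Euclid_dvdM // dvdn_prime2 // => /orP[/eqP //|].
case: (leqP (pdiv (p * m)) p.-1) => [le2|]; first by move/negP: (h _ qp le2).
lia.
Qed.

Lemma pdiv_count p N : prime p ->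
  \sum_(1 <= n < N.+1 | pdiv n == p) 1 = coprime_count (N %/ p) (primes_upto p.-1).
Proof.
move=> pp; rewrite (@Rsum_eq _ _ _ (fun n => (p %| n) && (pdiv n == p)) _ (fun=> 1)) //; last first.
  by move=> n _; case: eqP => [<-|]; rewrite ?andbF // pdiv_dvd.
rewrite (Rsum_multiples N (fun n => pdiv n == p) (fun=> 1) (prime_gt0 pp)).
apply: Rsum_eq => // m; rewrite mem_iota1 => /andP[m0 _]; exact: pdiv_eq_rough.
Qed.

Lemma log_pdiv_sumE N : log_pdiv_sum N =
  \sum_(1 <= p < N.+1 | prime p) ln (INR p) * coprime_count (N %/ p) (primes_upto p.-1).
Proof.
transitivity (\sum_(1 <= p < N.+1 | prime p) \sum_(1 <= n < N.+1 | pdiv n == p) ln (INR p)).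
  rewrite (exchange_big_dep xpredT) //=; apply: Rsum_eq => // n; rewrite mem_iota1 => /andP[n0 nN] _.
  case: (ltngtP n 1) => [|n1|->]; first by lia.
    rewrite big_mkcond (bigD1_seq (pdiv n)) ?iota_uniq //=; last first.
      by rewrite mem_iota1 pdiv_gt0 (leq_trans (pdiv_leq n0)).
    rewrite pdiv_prime // eqxx big1_seq ?Rplus_0_r // => p /andP[pn _].
    by rewrite eq_sym (negbTE pn) andbF.
  rewrite (_ : pdiv 1 = 1%N) // INR_1 ln_1 big1_seq // => p /andP[/andP[pp /eqP e] _].
  by rewrite -e INR_1 ln_1.
by apply: eq_bigr => p pp; rewrite -(pdiv_count N pp) -Rsum_mull; apply: eq_bigr => *; ring.
Qed.

Lemma size_primes_upto n : (size (primes_upto n) <= n)%N.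
Proof. by rewrite size_filter (leq_trans (count_size _ _)) // size_iota subn1. Qed.

Lemma prod_lam_le lam L : 0 <= lam -> all prime L ->
  \prod_(p <- L) (1 + lam / INR p) <= exp (lam * \sum_(p <- L) / INR p).
Proof.
move=> l0; elim: L => [|p L IH] /=; first by rewrite !big_nil Rmult_0_r exp_0; lra.
move=> /andP[pp aL]; rewrite !big_cons Rmult_plus_distr_l exp_plus.
have := Rinv_0_lt_compat _ (INR_pos (prime_gt0 pp)) => ip.
have lp := Rmult_le_pos _ _ l0 (Rlt_le _ _ ip).
apply: Rmult_le_compat; rewrite /Rdiv; first lra.
- apply: Rprod_ge0 => q qL _.
  have iq := Rinv_0_lt_compat _ (INR_pos (prime_gt0 (allP aL q qL))).
  by have := Rmult_le_pos _ _ l0 (Rlt_le _ _ iq); lra.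
- exact: exp_ineq1_le.
- exact: IH.
Qed.

Lemma sum_inv_prime_upto : exists C, 0 <= C /\ forall n N, (n <= N)%N -> (1 < N)%N ->
  \sum_(p <- primes_upto n) / INR p <= ln (ln (INR N)) + C.
Proof.
have [M [K [K0 h]]] := mertens2.
exists (Rabs M + 2 * K); split; first by have := Rabs_pos M; lra.
move=> n N nN N1; rewrite /primes_upto big_filter.
apply: (Rle_trans _ (\sum_(1 <= p < N.+1 | prime p) / INR p)).
  apply: Rsum_extend => // i _ ip; apply: Rlt_le; apply: Rinv_0_lt_compat; exact: INR_pos (prime_gt0 ip).
have := h N N1.
have l : 1 / 2 <= ln (INR N).
  by apply: (Rle_trans _ _ _ ln2_ge); apply: ln_le; [lra | rewrite -INR_2; exact: INR_leq].
have : K / ln (INR N) <= 2 * K.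
  by rewrite Rmult_comm; apply: Rmult_le_compat_l => //; have := Rinv_le_contravar (1/2) _ ltac:(lra) l; lra.
by split_Rabs; lra.
Qed.

Lemma sieve_error : exists C, 0 <= C /\ forall N p k, (1 < N)%N -> prime p -> (p <= N)%N ->
  Rabs (coprime_count (N %/ p) (primes_upto p.-1) - INR N / INR p * sieve_density (primes_upto p.-1)) <=
  INR p ^ k + C * (INR N / INR p) * exp (3 * ln (ln (INR N)) - INR k).
Proof.
have [C [C0 hC]] := sum_inv_prime_upto.
exists (exp (3 * C)); split; first exact: Rlt_le (exp_pos _).
move=> N p k N1 pp pN; have p0 := INR_pos (prime_gt0 pp).
have hX : INR (N %/ p) <= INR N / INR p < INR (N %/ p) + 1 by have := INR_divn N (prime_gt0 pp).
(* With lam = e the truncation gain is exp (-k), and e <= 3 bounds the product by exp (3 (ln ln N +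
   C)). *)
have h := @brun_sieve (exp 1) k _ _ _ (exp_pos 1) (primes_upto_prime p.-1) (primes_upto_uniq p.-1) hX.
apply: (Rle_trans _ _ _ h).
have h1 : INR (1 + size (primes_upto p.-1)) ^ k <= INR p ^ k.
  apply: pow_incr; split; first exact: pos_INR.
  by apply: INR_leq; have := size_primes_upto p.-1; have := prime_gt0 pp; lia.
have h2 := prod_lam_le (Rlt_le _ _ (exp_pos 1)) (primes_upto_prime p.-1).
have h3 := hC p.-1 N (leq_trans (leq_pred p) pN) N1.
have S0 : 0 <= \sum_(q <- primes_upto p.-1) / INR q.
  apply: Rsum_ge0 => q; rewrite mem_primes_upto => /andP[qp _] _.
  by apply: Rlt_le; apply: Rinv_0_lt_compat; exact: INR_pos (prime_gt0 qp).
have h4 : exp (exp 1 * \sum_(q <- primes_upto p.-1) / INR q) <= exp (3 * (ln (ln (INR N)) + C)).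
  by apply: exp_le; apply: Rmult_le_compat => //; [exact: Rlt_le (exp_pos _) | exact: exp_le_3].
have -> : (/ exp 1) ^ k = exp (- INR k).
  by rewrite -exp_Ropp exp_pow; congr exp; ring.
have -> : exp (3 * C) * (INR N / INR p) * exp (3 * ln (ln (INR N)) - INR k) =
   INR N / INR p * exp (- INR k) * exp (3 * (ln (ln (INR N)) + C)).
  have e : exp (3 * C) * exp (3 * ln (ln (INR N)) - INR k) =
      exp (- INR k) * exp (3 * (ln (ln (INR N)) + C)).
    by rewrite -!exp_plus; congr exp; ring.
  by rewrite (Rmult_assoc _ (exp _)) -e; ring.
apply: Rplus_le_compat => //; apply: Rmult_le_compat_l; last lra.
apply: Rmult_le_pos; last exact: Rlt_le (exp_pos _).
by apply: Rdiv_le_0_compat => //; exact: pos_INR.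
Qed.

Lemma log_pdiv_large : exists C, 0 <= C /\ forall N z, (1 < z <= N)%N ->
  0 <= \sum_(z.+1 <= p < N.+1 | prime p) ln (INR p) * coprime_count (N %/ p) (primes_upto p.-1) <=
  INR N * (20 * (ln (ln (INR N)) - ln (ln (INR z))) + C).
Proof.
have [M [K [K0 h]]] := mertens2.
(* 20 times the error 4K in the difference of two Mertens sums, plus 4 from [psi N <= 4 N]. *)
exists (80 * K + 4); split; first lra.
move=> N z /andP[z1 zN]; split.
  apply: Rsum_ge0 => p _ pp; apply: Rmult_le_pos; first exact: ln_INR_ge0.
  by have := coprime_count_bounds (N %/ p) (primes_upto p.-1); lra.
have N0 := pos_INR N.
apply: (Rle_trans _ (20 * INR N * \sum_(z.+1 <= p < N.+1 | prime p) / INR p + psi N)); last first.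
  have h1 := h N (leq_trans z1 zN); have h2 := h z z1.
  rewrite (big_cat_nat (n := z.+1)) //= in h1.
  have lb n : (1 < n)%N -> K / ln (INR n) <= 2 * K.
    move=> n1; have l : 1 / 2 <= ln (INR n).
      by apply: (Rle_trans _ _ _ ln2_ge); apply: ln_le; [lra | rewrite -INR_2; exact: INR_leq].
    by rewrite Rmult_comm; apply: Rmult_le_compat_l => //; have := Rinv_le_contravar (1/2) _ ltac:(lra) l; lra.
  have l1 := lb N (leq_trans z1 zN); have l2 := lb z z1; have l3 := psi_le N.
  set S := \sum_(z.+1 <= p < N.+1 | prime p) / INR p in h1 *.
  have : S <= ln (ln (INR N)) - ln (ln (INR z)) + 4 * K by move: h1 h2; split_Rabs; lra.
  move=> hS; have := Rmult_le_compat_l _ _ _ N0 hS; lra.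
have hpsi : \sum_(z.+1 <= p < N.+1 | prime p) ln (INR p) <= psi N.
  rewrite (eq_bigr mangoldt); last by move=> p pp; rewrite mangoldt_prime.
  rewrite /psi (big_cat_nat (n := z.+1) (m := 1%N) (p := N.+1)) //=.
  have : 0 <= \sum_(1 <= d < z.+1) mangoldt d by apply: Rsum_ge0 => *; exact: mangoldt_ge0.
  have : \sum_(z.+1 <= p < N.+1 | prime p) mangoldt p <= \sum_(z.+1 <= p < N.+1) mangoldt p.
    by apply: Rsum_leP => // *; exact: mangoldt_ge0.
  lra.
apply: (Rle_trans _ (\sum_(z.+1 <= p < N.+1 | prime p) (20 * INR N * / INR p + ln (INR p)))); last first.
  by rewrite Rsum_add Rsum_mull; apply: Rplus_le_compat_l; exact: hpsi.
apply: Rsum_le => p; rewrite mem_index_iota => /andP[zp pN] pp.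
have p0 := INR_pos (prime_gt0 pp); have p1 := prime_gt1 pp.
have lp := ln_prime_ge pp.
have q0 : 0 <= 20 * INR N * / INR p.
  by apply: Rmult_le_pos; [lra | apply: Rlt_le; exact: Rinv_0_lt_compat].
case: (leqP p (N %/ p)) => hp.
  have hx : (0 < p.-1 <= N %/ p)%N by lia.
  have := rough_count hx ltac:(lia); rewrite prednK; last by lia.
  move=> hc; have := Rmult_le_compat_l (ln (INR p)) _ _ ltac:(lra) hc.
  have -> : ln (INR p) * (20 * INR (N %/ p) / ln (INR p)) = 20 * INR (N %/ p) by field; lra.
  have [hd _] := INR_divn N (prime_gt0 pp); rewrite /Rdiv in hd; lra.
(* Here N/p < p, so every m in 2..N/p has a prime factor below p and only m = 1 is counted; these
   terms add up to at most [psi N]. *)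
have x0 : (0 < N %/ p)%N by rewrite divn_gt0 ?prime_gt0.
by rewrite /coprime_count coprime_sum_primes //; [lra | lia].
Qed.

(** Applied to x = ln ln N, this makes ln N / (k + 2) at least 2 in the choice of the cutoff. *)
Lemma exp_ge_10 x : 12 <= x -> 10 * x <= exp x.
Proof.
move=> x12; have h := exp_ineq1_le (x / 3).
have -> : exp x = exp (x / 3) ^ 3 by rewrite /= Rmult_1_r -!exp_plus; congr exp; field.
apply: (Rle_trans _ ((1 + x / 3) ^ 3)); last by apply: pow_incr; lra.
have := Rmult_le_pos (x - 12) (x - 12) ltac:(lra) ltac:(lra) => h2.
have h3 : 10 <= (1 + x / 3 + x * x / 27) by lra.
have := Rmult_le_compat_l x _ _ ltac:(lra) h3; rewrite /=; lra.
Qed.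

(* Take [z = floor (N ^ (1 / (k + 2)))] with [k = floor (4 ln ln N) + 1]. *)
Lemma cutoff N : 12 <= ln (ln (INR N)) -> exists z k : nat,
  [/\ (1 < z <= N)%N, INR z ^ (k + 2) <= INR N, 4 * ln (ln (INR N)) <= INR k, 1 <= ln (INR z) &
      0 <= ln (ln (INR N)) - ln (ln (INR z)) <= 11 + ln (ln (ln (INR N)))].
Proof.
set l2 := ln (ln (INR N)) => l12.
have lN : ln (INR N) = exp l2.
  rewrite /l2 exp_ln //; case: (Rlt_le_dec 0 (ln (INR N))) => // h.
  by move: l12; rewrite /l2 ln_nonpos //; lra.
have N0 : 0 < INR N.
  case: (Rlt_le_dec 0 (INR N)) => // h; have := exp_pos l2; rewrite -lN.
  by rewrite ln_nonpos //; lra.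
have [k1 k2] := @nat_floorP (4 * l2) ltac:(lra).
set k := (nat_floor (4 * l2)).+1; have kE : INR k = INR (nat_floor (4 * l2)) + 1 by exact: S_INR.
have h10 := exp_ge_10 l12.
have k2E : INR (k + 2) = INR k + 2 by rewrite plus_INR INR_2.
have kp : 0 < INR (k + 2) by lra.
set v := ln (INR N) / INR (k + 2).
have v1 : 2 <= v.
  apply: (Rmult_le_reg_r (INR (k + 2))) => //.
  by rewrite /v /Rdiv Rmult_assoc Rinv_l; lra.
have [z1 z2] := nat_floorP (Rlt_le _ _ (exp_pos v)).
set z := nat_floor (exp v) in z1 z2.
have ev : exp v = exp (v - 1) * exp 1 by rewrite -exp_plus; congr exp; ring.
have e1 := exp1_ge2; have e2 := exp_ineq1_le (v - 1).
have z3 : exp (v - 1) <= INR z.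
  have := Rmult_le_compat_l (exp (v - 1)) _ _ (Rlt_le _ _ (exp_pos _)) e1; lra.
have zp : 0 < INR z by lra.
have lz1 : v - 1 <= ln (INR z) by rewrite -(ln_exp (v - 1)); apply: ln_le => //; exact: exp_pos.
have lz2 : ln (INR z) <= v by rewrite -(ln_exp v); apply: ln_le.
have zN : INR z <= INR N.
  have : ln (INR z) <= ln (INR N).
    apply: (Rle_trans _ _ _ lz2); apply: (Rmult_le_reg_r (INR (k + 2))) => //.
    rewrite /v /Rdiv Rmult_assoc Rinv_l; last lra.
    by apply: Rmult_le_compat_l; [rewrite lN; exact: Rlt_le (exp_pos _) | lra].
  by move=> h; rewrite -(exp_ln (INR z)) // -(exp_ln (INR N)) //; exact: exp_le.
exists z, k; split.
- apply/andP; split; last exact: leq_INR.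
  apply/ltP; apply: INR_lt; rewrite INR_1.
  lra.
- have -> : INR N = exp v ^ (k + 2).
    rewrite -[exp v](f_equal exp (Ropp_involutive v)) exp_pow Ropp_involutive /v.
    have -> : ln (INR N) / INR (k + 2) * INR (k + 2) = ln (INR N) by field; lra.
    by rewrite exp_ln.
  by apply: pow_incr; lra.
- lra.
- lra.
- have lzp : 0 < ln (INR z) by lra.
  split.
    suff : ln (ln (INR z)) <= l2 by lra.
    by rewrite /l2; apply: ln_le => //; apply: ln_le.
  (* ln z >= v - 1 >= v/2 since v >= 2. Then 2 (k + 2) <= 12 ln ln N, and ln 12 <= 11 is the 11 of
     the statement. *)
  have h1 : ln (v / 2) <= ln (ln (INR z)) by apply: ln_le; lra.
  have h2 : ln (v / 2) = l2 - ln (2 * INR (k + 2)).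
    rewrite /l2 -ln_div; [|rewrite lN; exact: exp_pos|lra].
    by congr ln; rewrite /v; field; lra.
  have h3 : ln (2 * INR (k + 2)) <= ln (12 * l2) by apply: ln_le; lra.
  have h3' : ln (12 * l2) = ln 12 + ln l2 by apply: ln_mult; lra.
  have h4 := @ln_le_sub1 12 ltac:(lra); lra.
Qed.

Lemma log_pdiv_sum_asymp : exists C N0, 0 <= C /\ forall N, (N0 <= N)%N ->
  1 <= ln (ln (ln (INR N))) /\
  Rabs (log_pdiv_sum N - INR N * (exp (- euler_gamma) * ln (ln (INR N)))) <=
    C * (INR N * ln (ln (ln (INR N)))).
Proof.
have [C1 [C1p h1]] := sieve_error.
have [C2 [C2p h2]] := sieve_density_asymp.
have [C3 [C3p h3]] := sum_inv_p_ln_bounded.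
have [C4 [C4p h4]] := log_pdiv_large.
have [M [K [Kp h5]]] := mertens2.
set g := exp (- euler_gamma); have g0 : 0 < g by exact: exp_pos.
(* All bounded contributions: the sieve, the two errors of Mertens' second theorem, the primes above
   z, and the 11 from the cutoff counted in both ranges. They are absorbed by ln ln ln N >= 1. *)
set B := 1 + 7 * C1 + C2 * C3 + g * (Rabs M + K) + C4 + 11 * (20 + g).
have Mp := Rabs_pos M.
have B0 : 0 <= B.
  have := Rmult_le_pos _ _ C2p C3p; have := Rmult_le_pos g (Rabs M + K) ltac:(lra) ltac:(lra).
  by rewrite /B; lra.
have [N0 hN0] := ln_INR_eventually_ge (exp 12).
exists (B + 20 + g), N0; split; first lra.
move=> N NN; set l2 := ln (ln (INR N)); set l3 := ln l2.
have lN12 := hN0 N NN.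
have l12 : 12 <= l2 by rewrite -(ln_exp 12) /l2; apply: ln_le => //; exact: exp_pos.
have l31 : 1 <= l3.
  by rewrite /l3 -(ln_exp 1); apply: ln_le; [exact: exp_pos | have := exp_le_3; lra].
split => //.
have [z [k [/andP[z1 zN] zk k4 lz [d0 d1]]]] := cutoff l12.
rewrite -/l2 -/l3 in k4 d0 d1.
have N1 : (1 < N)%N := leq_trans z1 zN.
have NR := pos_INR N.
have lN : ln (INR N) = exp l2 by rewrite /l2 exp_ln //; exact: ln_INR_gt0.
have [t0 t1] := h4 N z ltac:(rewrite z1; exact: zN).
rewrite log_pdiv_sumE (big_cat_nat (n := z.+1) (m := 1%N) (p := N.+1)) //=.
set T2 := \sum_(z.+1 <= p < N.+1 | prime p) ln (INR p) * coprime_count (N %/ p) (primes_upto p.-1) in t0 t1 *.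
set T1 := \sum_(1 <= p < z.+1 | prime p) ln (INR p) * coprime_count (N %/ p) (primes_upto p.-1).
rewrite -/l2 in t1.
set S := \sum_(1 <= p < z.+1 | prime p) / INR p.
set ex := exp (3 * l2 - INR k).
have ex0 : 0 < ex by exact: exp_pos.
have main : Rabs (T1 - INR N * g * S) <= INR N * (1 + 7 * C1 + C2 * C3).
  have e : T1 - INR N * g * S = \sum_(1 <= p < z.+1 | prime p)
     (ln (INR p) * coprime_count (N %/ p) (primes_upto p.-1) - INR N * g * / INR p).
    by rewrite Rsum_sub Rsum_mull.
  rewrite e; apply: (Rle_trans _ _ _ (Rsum_abs _ _ _)).
  apply: (Rle_trans _ (\sum_(1 <= p < z.+1 | prime p)
     (INR z ^ k.+1 + (C1 * INR N * ex * (ln (INR p) / INR p) + C2 * INR N * / (INR p * ln (INR p)))))).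
    apply: Rsum_le => p; rewrite mem_iota1 => /andP[p0 pz] pp.
    have ip := INR_pos p0; have lp := ln_prime_ge pp.
    have a1 := h1 N p k N1 pp (leq_trans pz zN); have a2 := h2 p pp; rewrite -/l2 -/ex in a1.
    rewrite -/g in a2.
    move: a1 a2; set A := coprime_count _ _; set W := sieve_density _ => a1 a2.
    have -> : ln (INR p) * A - INR N * g * / INR p =
       ln (INR p) * (A - INR N / INR p * W) + INR N / INR p * (W * ln (INR p) - g) by field; lra.
    have NP : 0 <= INR N / INR p by apply: Rdiv_le_0_compat.
    apply: (Rle_trans _ _ _ (Rabs_triang _ _)).
    rewrite (Rabs_mult (ln (INR p))) (Rabs_mult (INR N / INR p)) (Rabs_pos_eq (ln _)); last lra.
    rewrite (Rabs_pos_eq (INR N / INR p)) //.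
    have b1 := Rmult_le_compat_l (ln (INR p)) _ _ ltac:(lra) a1.
    have b2 := Rmult_le_compat_l _ _ _ NP a2.
    have b3 : ln (INR p) * INR p ^ k <= INR z ^ k.+1.
      have pzR := INR_leq pz.
      apply: Rmult_le_compat; [lra | by apply: pow_le; lra | | by apply: pow_incr; lra].
      have := ln_le_sub1 ip; lra.
    have e1 : C1 * INR N * ex * (ln (INR p) / INR p) = ln (INR p) * (C1 * (INR N / INR p) * ex) by field; lra.
    have e2 : C2 * INR N * / (INR p * ln (INR p)) = INR N / INR p * (C2 / ln (INR p)) by field; lra.
    rewrite e1 e2; lra.
  rewrite Rsum_add.
  (* At most z primes, each with rounding error z^(k+1): this is where z^(k+2) <= N is needed. *)
  have c1 : \sum_(1 <= p < z.+1 | prime p) INR z ^ k.+1 <= INR N.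
    apply: Rle_trans zk.
    have zk0 : 0 <= INR z ^ k.+1 by apply: pow_le; exact: pos_INR.
    apply: (Rle_trans _ _ _ (@Rsum_const_le _ _ _ _ (INR z ^ k.+1) zk0 _)).
      by move=> *; lra.
    by rewrite size_iota subn1 /= addn2; right; rewrite /=; ring.
  have c2 : \sum_(1 <= p < z.+1 | prime p) (C1 * INR N * ex * (ln (INR p) / INR p)) <= 7 * C1 * INR N.
    rewrite Rsum_mull.
    have z0 : (0 < z)%N by lia.
    have := mertens1 z0; set Q := \sum_(1 <= p < z.+1 | prime p) ln (INR p) / INR p => hQ.
    have lzN : ln (INR z) <= ln (INR N) by apply: ln_le; [exact: INR_pos | exact: INR_leq].
    have Q1 : Q <= exp l2 + 6 by rewrite -lN; move: hQ; split_Rabs; lra.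
    (* k >= 4 ln ln N gives [ex <= 1/ln N], which cancels the growth [Q <= ln N + 6]. *)
    have q1 : ex * Q <= 7.
      have x1 : ex <= exp (- l2) by apply: exp_le; lra.
      have x2 : exp (- l2) <= 1 by rewrite -exp_0; apply: exp_le; lra.
      have := Rmult_le_compat_l ex _ _ (Rlt_le _ _ ex0) Q1.
      have := Rmult_le_compat_r (exp l2 + 6) _ _ ltac:(have := exp_pos l2; lra) x1.
      have : exp (- l2) * exp l2 = 1 by rewrite -exp_plus Rplus_opp_l exp_0.
      lra.
    have := Rmult_le_compat_l (C1 * INR N) _ _ (Rmult_le_pos _ _ C1p NR) q1; lra.
  have c3 : \sum_(1 <= p < z.+1 | prime p) (C2 * INR N * / (INR p * ln (INR p))) <= C2 * INR N * C3.
    rewrite Rsum_mull; apply: Rmult_le_compat_l; first exact: Rmult_le_pos.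
    exact: h3.
  apply: (Rle_trans _ (INR N + (7 * C1 * INR N + C2 * INR N * C3))); last by right; ring.
  apply: Rplus_le_compat; first exact: c1.
  by rewrite Rsum_add; apply: Rplus_le_compat; [exact: c2 | exact: c3].
have hS := h5 z z1; rewrite -/S in hS.
have hK : K / ln (INR z) <= K.
  rewrite -[X in _ <= X]Rmult_1_r; apply: Rmult_le_compat_l => //.
  by rewrite -Rinv_1; apply: Rinv_le_contravar; lra.
have hS2 : Rabs (S - l2) <= Rabs M + K + (11 + l3) by move: hS; split_Rabs; lra.
have hS3 : Rabs (INR N * g * S - INR N * (g * l2)) <= INR N * (g * (Rabs M + K + (11 + l3))).
  have -> : INR N * g * S - INR N * (g * l2) = INR N * g * (S - l2) by ring.
  have Ng := Rmult_le_pos _ _ NR (Rlt_le _ _ g0).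
  by rewrite Rabs_mult (Rabs_pos_eq _ Ng) Rmult_assoc -!Rmult_assoc; apply: Rmult_le_compat_l.
have tot : Rabs (T1 + T2 - INR N * (g * l2)) <= INR N * (B + (20 + g) * l3).
  have f1 : INR N * (20 * (l2 - ln (ln (INR z))) + C4) <= INR N * (20 * (11 + l3) + C4).
    by apply: Rmult_le_compat_l; lra.
  have f2 : INR N * (B + (20 + g) * l3) = INR N * (1 + 7 * C1 + C2 * C3) +
     INR N * (g * (Rabs M + K + (11 + l3))) + INR N * (20 * (11 + l3) + C4) by rewrite /B; ring.
  by rewrite f2; move: main hS3; split_Rabs; lra.
apply: (Rle_trans _ _ _ tot).
have -> : (B + 20 + g) * (INR N * l3) = INR N * (B * l3 + (20 + g) * l3) by ring.
apply: Rmult_le_compat_l => //.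
by have := Rmult_le_compat_l B _ _ B0 l31; lra.
Qed.

(** * Aliquot sums *)

Lemma eqb_mod_dvdn d n : (0 < d)%N -> Nat.eqb (Nat.modulo n d) 0 = (d %| n).
Proof.
move=> d0; apply/idP/idP => [/Nat.eqb_spec h|/dvdnP [k ->]].
  have [k hk] := proj1 (Nat.Lcm0.mod_divide n d) h.
  by apply/dvdnP; exists k.
by apply/Nat.eqb_spec; apply/Nat.Lcm0.mod_divide; exists k.
Qed.

Lemma aliquotE n : INR (aliquot n) = \sum_(1 <= d < n | d %| n) INR d.
Proof.
rewrite /aliquot /index_iota -[(n - 1)%coq_nat]/(n - 1)%N.
have : all (fun d => 0 < d)%N (iota 1 (n - 1)) by apply/allP => d; rewrite mem_iota => /andP[].
have -> : List.seq 1 (n - 1)%N = iota 1 (n - 1) by elim: (n - 1)%N 1%N => // m IH a /=; rewrite IH.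
elim: (iota 1 (n - 1)) => [|d l IH] /=; first by rewrite big_nil.
move=> /andP[d0 /IH h]; rewrite big_cons eqb_mod_dvdn //; case: ifP => _ //=.
by rewrite plus_INR h.
Qed.

(* With [p = pdiv n], the proper divisor [d = n / e] other than [n / p] contributes [p / e] to
   [p s(n) / n - 1]; when [e] is composite, [p ^ 2 <= e]. *)
Definition cofactor_bound (p e : nat) : R :=
  if prime e then (if (p < e)%N then INR p / INR e else 0)
  else if (1 < e)%N then / sqrt (INR e) else 0.

Lemma cofactor_bound_ge0 p e : 0 <= cofactor_bound p e.
Proof.
rewrite /cofactor_bound; case: ifP => [ep|_].
  case: ifP => _; last lra.
  by apply: Rdiv_le_0_compat; [exact: pos_INR | exact: INR_pos (prime_gt0 ep)].
case: ifP => [e1|_]; last lra.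
by apply: Rlt_le; apply: Rinv_0_lt_compat; apply: sqrt_lt_R0; apply: INR_pos; lia.
Qed.

(** If e = n/d is composite, its own least prime factor is at least p and at most sqrt e, whence p/e
    <= 1/sqrt e. *)
Lemma cofactor_boundP n d : (1 < n)%N -> (0 < d < n)%N -> d %| n -> d != (n %/ pdiv n)%N ->
  INR (pdiv n) * INR d / INR n <= cofactor_bound (pdiv n) (n %/ d).
Proof.
move=> n1 /andP[d0 dn] dvd dp; set p := pdiv n in dp *; set e := (n %/ d)%N.
have n0 : (0 < n)%N by lia.
have nE : n = (e * d)%N by rewrite /e divnK.
have e1 : (1 < e)%N by rewrite ltnNge; apply/negP => h; move: dn; rewrite nE; nia.
have en : e %| n by rewrite nE dvdn_mulr.
have pp : prime p by exact: pdiv_prime.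
have pe : (p <= e)%N by exact: pdiv_min_dvd.
have pne : p != e.
  apply: contraNneq dp => pE; rewrite pE {1}nE mulKn //; lia.
have plt : (p < e)%N by rewrite ltn_neqAle pne.
have eR := INR_pos (ltnW e1); have dR := INR_pos d0.
have -> : INR p * INR d / INR n = INR p / INR e by rewrite nE mulnINR; field; lra.
rewrite /cofactor_bound; case: ifP => ep; first by rewrite plt; lra.
rewrite e1.
have q2 : (pdiv e ^ 2 <= e)%N.
  by rewrite leqNgt; apply/negP => h; move: ep; rewrite (ltn_pdiv2_prime (ltnW e1) h).
have pq : (p <= pdiv e)%N.
  by apply: pdiv_min_dvd; [apply: prime_gt1; exact: pdiv_prime | exact: dvdn_trans (pdiv_dvd e) en].
have p2 : (p * p <= e)%N by apply: leq_trans q2; rewrite expnS expn1 leq_mul.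
have sp := sqrt_lt_R0 _ eR; have ss := sqrt_sqrt _ (Rlt_le _ _ eR).
have h : INR p <= sqrt (INR e).
  rewrite -(sqrt_square (INR p)); last exact: pos_INR.
  by apply: sqrt_le_1_alt; rewrite -mulnINR; exact: INR_leq.
apply: (Rmult_le_reg_r (INR e)) => //.
rewrite /Rdiv Rmult_assoc Rinv_l ?Rmult_1_r; last lra.
by rewrite -{2}ss -Rmult_assoc Rinv_l ?Rmult_1_l //; lra.
Qed.

(** The divisor n/p contributes exactly 1; all the others go into the cofactor sum. *)
Lemma ratio_bounds n : (1 < n)%N ->
  1 <= INR (pdiv n) * INR (aliquot n) / INR n <=
  1 + \sum_(1 <= d < n.+1 | d %| n) cofactor_bound (pdiv n) (n %/ d).
Proof.
move=> n1; have n0 : (0 < n)%N by lia.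
have nR := INR_pos n0; set p := pdiv n; have pp : prime p by exact: pdiv_prime.
have pn : p %| n by exact: pdiv_dvd.
set m := (n %/ p)%N; have nE : n = (p * m)%N by rewrite mulnC divnK.
have p1 := prime_gt1 pp.
have m0 : (0 < m)%N by rewrite lt0n; apply/eqP => h; move: n0; rewrite nE h muln0.
have mn : (m < n)%N by rewrite nE; apply: ltn_Pmull.
have -> : INR p * INR (aliquot n) / INR n = \sum_(1 <= d < n | d %| n) (INR p / INR n * INR d).
  by rewrite Rsum_mull -aliquotE; field; lra.
have mdiv : m %| n by rewrite nE dvdn_mull.
rewrite [\sum_(1 <= d < n | d %| n) (INR p / INR n * INR d)]big_mkcond.
rewrite (bigD1_seq m) ?iota_uniq ?mem_index_iota ?m0 //= mdiv.
have pR := INR_pos (prime_gt0 pp); have mR := INR_pos m0.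
have -> : INR p / INR n * INR m = 1 by rewrite {1}nE mulnINR; field; lra.
have F0 d : 0 <= INR p / INR n * INR d.
  by apply: Rmult_le_pos; [apply: Rdiv_le_0_compat; lra | exact: pos_INR].
split.
  have : 0 <= \sum_(1 <= d < n | d != m) (if d %| n then INR p / INR n * INR d else 0).
    by apply: Rsum_ge0 => d _ _; case: ifP => _; [exact: F0 | lra].
  lra.
apply: Rplus_le_compat_l.
apply: (Rle_trans _ (\sum_(1 <= d < n | d %| n) cofactor_bound p (n %/ d))); last first.
  by apply: Rsum_extend => // d _ _; exact: cofactor_bound_ge0.
rewrite big_mkcond [X in _ <= X]big_mkcond /=; apply: Rsum_le => d.
rewrite mem_index_iota => dn _; have G0 := cofactor_bound_ge0 p (n %/ d).
case: ifP => [dm|_]; case: ifP => [dv|_]; try lra.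
have -> : INR p / INR n * INR d = INR p * INR d / INR n by field; lra.
exact: cofactor_boundP.
Qed.

(** Telescoping against - 2/sqrt x, an antiderivative of x^(-3/2). *)
Lemma sum_inv_sqrt_bound N : \sum_(1 <= m < N.+1) / (INR m * sqrt (INR m)) <= 3.
Proof.
case: N => [|N]; first by rewrite big_geq //; lra.
suff : \sum_(1 <= m < N.+2) / (INR m * sqrt (INR m)) <= 3 - 2 * / sqrt (INR N.+1).
  have := Rinv_0_lt_compat _ (sqrt_lt_R0 _ (INR_pos (ltn0Sn N))); lra.
elim: N => [|N IH]; first by rewrite big_nat1 INR_1 sqrt_1; lra.
rewrite big_nat_recr //=; have aR := INR_pos (ltn0Sn N); have bR := INR_pos (ltn0Sn N.+1).
have ab : INR N.+2 = INR N.+1 + 1 by exact: S_INR.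
have a0 := sqrt_lt_R0 _ aR; have b0 := sqrt_lt_R0 _ bR.
have aa := sqrt_sqrt _ (Rlt_le _ _ aR); have bb := sqrt_sqrt _ (Rlt_le _ _ bR).
have sab : sqrt (INR N.+1) <= sqrt (INR N.+2) by apply: sqrt_le_1_alt; lra.
set a := sqrt (INR N.+1) in a0 aa sab IH *; set b := sqrt (INR N.+2) in b0 bb sab *.
suff : / (INR N.+2 * b) <= 2 * / a - 2 * / b by move: IH; lra.
rewrite -bb.
have -> : 2 * / a - 2 * / b = 2 * (b - a) * / (a * b) by field; lra.
have h : 1 = (b - a) * (b + a) by rewrite -(_ : b * b - a * a = (b - a) * (b + a)); [lra | ring].
have -> : / (b * b * b) = (b - a) * ((b + a) * / (b * b * b)) by rewrite -Rmult_assoc -h; ring.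
have -> : 2 * (b - a) * / (a * b) = (b - a) * (2 * / (a * b)) by ring.
apply: Rmult_le_compat_l; first lra.
have -> : 2 * / (a * b) = (2 * b * b) * / (a * b * b * b) by field; lra.
have -> : (b + a) * / (b * b * b) = ((b + a) * a) * / (a * b * b * b) by field; lra.
apply: Rmult_le_compat_r.
  by apply: Rlt_le; apply: Rinv_0_lt_compat; repeat apply: Rmult_lt_0_compat.
have := Rmult_le_compat a b a b ltac:(lra) ltac:(lra) sab sab.
have := Rmult_le_compat_l b a b ltac:(lra) sab; lra.
Qed.

(** If p = [pdiv (d * q)] is below q, then p divides d. There are at most N/(pq) such d, each of
    weight p/q, so every prime p <= q contributes at most N/q^2, and there are at most 5 q / ln q
    such primes. *)
Lemma cofactor_prime_sum N q : prime q -> (q <= N)%N ->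
  \sum_(1 <= d < (N %/ q).+1) cofactor_bound (pdiv (d * q)) q <= 5 * INR N * / (INR q * ln (INR q)).
Proof.
move=> qp qN; have qR := INR_pos (prime_gt0 qp); have lq := ln_prime_ge qp.
apply: (Rle_trans _ (\sum_(1 <= d < (N %/ q).+1) \sum_(1 <= p < q.+1 | prime p && (p %| d)) INR p / INR q)).
  apply: Rsum_le => d; rewrite mem_iota1 => /andP[d0 _] _.
  have S0 : 0 <= \sum_(1 <= p < q.+1 | prime p && (p %| d)) INR p / INR q.
    by apply: Rsum_ge0 => p _ _; apply: Rdiv_le_0_compat => //; exact: pos_INR.
  rewrite /cofactor_bound qp; case: ifP => // pq.
  have dq1 : (1 < d * q)%N by rewrite (leq_trans (prime_gt1 qp)) // leq_pmull.
  have pp := pdiv_prime dq1.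
  apply: (@Rsum_le1 _ _ (fun p => prime p && (p %| d)) (fun p => INR p / INR q)).
  - by rewrite mem_iota1 pdiv_gt0 ltnW.
  - rewrite pp /=; have := pdiv_dvd (d * q); rewrite Euclid_dvdM // => /orP[//|].
    by rewrite dvdn_prime2 // => /eqP e; rewrite e ltnn in pq.
  - by move=> p _ _; apply: Rdiv_le_0_compat => //; exact: pos_INR.
rewrite (exchange_big_dep prime) /=; last by move=> d p _ /andP[].
have NR := pos_INR N.
apply: (Rle_trans _ (\sum_(1 <= p < q.+1 | prime p) (INR N / (INR q * INR q) * 1))).
  apply: Rsum_le => p; rewrite mem_iota1 => /andP[p0 _] pp; have pR := INR_pos p0.
  rewrite (eq_bigl (fun d => p %| d)); last by move=> d; rewrite pp.
  rewrite (Rsum_count_multiples (N %/ q) (INR p / INR q) p0).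
  have [h1 _] := INR_divn (N %/ q) p0; have [h2 _] := INR_divn N (prime_gt0 qp).
  have h3 : INR (N %/ q %/ p) * INR p <= INR N / INR q.
    apply: Rle_trans h2; have := Rmult_le_compat_r (INR p) _ _ ltac:(lra) h1.
    by rewrite /Rdiv Rmult_assoc Rinv_l ?Rmult_1_r //; lra.
  have := Rmult_le_compat_r (/ INR q) _ _ (Rlt_le _ _ (Rinv_0_lt_compat _ qR)) h3.
  have -> : INR N / INR q * / INR q = INR N / (INR q * INR q) * 1 by field; lra.
  by rewrite /Rdiv; lra.
rewrite Rsum_mull.
have := prime_count_le (prime_gt1 qp) => h.
have c0 : 0 <= INR N / (INR q * INR q) by apply: Rdiv_le_0_compat => //; exact: Rmult_lt_0_compat.
apply: (Rle_trans _ _ _ (Rmult_le_compat_l _ _ _ c0 h)).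
by right; field; lra.
Qed.

(** Ordered by the cofactor m, prime m give the bounded sum of 1/(m ln m), and the other m give at
    most N/m terms of size 1/sqrt m. *)
Lemma cofactor_sum : exists C, 0 <= C /\ forall N,
  \sum_(1 <= n < N.+1) \sum_(1 <= d < n.+1 | d %| n) cofactor_bound (pdiv n) (n %/ d) <= C * INR N.
Proof.
have [C [C0 hC]] := sum_inv_p_ln_bounded.
exists (5 * C + 3); split; first lra.
move=> N; have NR := pos_INR N.
rewrite (Rsum_divisors_swap N xpredT (fun n d => cofactor_bound (pdiv n) (n %/ d))).
rewrite (hyperbola_swap N xpredT (fun d m => cofactor_bound (pdiv (d * m)) (d * m %/ d))).
apply: (Rle_trans _ (\sum_(1 <= m < N.+1)
  ((if prime m then 5 * INR N * / (INR m * ln (INR m)) else 0) + INR N * / (INR m * sqrt (INR m))))).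
  apply: Rsum_le => m; rewrite mem_iota1 => /andP[m0 mN] _; have mR := INR_pos m0.
  have sm := sqrt_lt_R0 _ mR.
  have im : 0 <= INR N * / (INR m * sqrt (INR m)).
    by apply: Rmult_le_pos => //; apply: Rlt_le; apply: Rinv_0_lt_compat; exact: Rmult_lt_0_compat.
  rewrite (@Rsum_eq _ _ _ xpredT _ (fun d => cofactor_bound (pdiv (d * m)) m)) //; last first.
    by move=> d; rewrite mem_iota1 => /andP[d0 _] _; rewrite mulKn.
  case: ifP => mp; first by apply: (Rle_trans _ _ _ (cofactor_prime_sum mp mN)); lra.
  rewrite Rplus_0_l.
  apply: (Rle_trans _ (\sum_(1 <= d < (N %/ m).+1) / sqrt (INR m))).
    apply: Rsum_le => d _ _; rewrite /cofactor_bound mp; case: ifP => _; first lra.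
    by apply: Rlt_le; exact: Rinv_0_lt_compat.
  rewrite Rsum_count; have [h _] := INR_divn N m0.
  have := Rmult_le_compat_r _ _ _ (Rlt_le _ _ (Rinv_0_lt_compat _ sm)) h.
  by rewrite Rinv_mult /Rdiv; lra.
rewrite Rsum_add -big_mkcond Rsum_mull Rsum_mull.
have := Rmult_le_compat_l (5 * INR N) _ _ ltac:(lra) (hC N).
have := Rmult_le_compat_l _ _ _ NR (sum_inv_sqrt_bound N).
move=> h1 h2; apply: (Rle_trans _ _ _ (Rplus_le_compat _ _ _ _ h2 h1)); lra.
Qed.

Lemma aliquot_gt0 n : (1 < n)%N -> 0 < INR (aliquot n).
Proof.
move=> n1; have [h _] := ratio_bounds n1; have nR := INR_pos (ltnW n1).
case: (Rlt_le_dec 0 (INR (aliquot n))) => // h0.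
have e : INR (aliquot n) = 0 by have := pos_INR (aliquot n); lra.
by move: h; rewrite e Rmult_0_r /Rdiv Rmult_0_l; lra.
Qed.

Lemma ln_aliquot_ratio n : (1 < n)%N ->
  0 <= ln (INR (aliquot n) / INR n) + ln (INR (pdiv n)) <=
  \sum_(1 <= d < n.+1 | d %| n) cofactor_bound (pdiv n) (n %/ d).
Proof.
move=> n1; have [h1 h2] := ratio_bounds n1; have nR := INR_pos (ltnW n1).
have aR := aliquot_gt0 n1; have pR := INR_pos (pdiv_gt0 n).
rewrite -ln_mult //; last exact: Rdiv_lt_0_compat.
have -> : INR (aliquot n) / INR n * INR (pdiv n) = INR (pdiv n) * INR (aliquot n) / INR n by field; lra.
split; first exact: ln_ge0.
by have := @ln_le_sub1 (INR (pdiv n) * INR (aliquot n) / INR n) ltac:(lra); lra.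
Qed.

Lemma log_ratio_sum_bounds N :
  0 <= log_ratio_sum N + log_pdiv_sum N <=
  \sum_(1 <= n < N.+1) \sum_(1 <= d < n.+1 | d %| n) cofactor_bound (pdiv n) (n %/ d).
Proof.
rewrite /log_pdiv_sum; elim: N => [|[|N] IH].
- by rewrite !big_geq //=; lra.
- rewrite !big_nat1 /= (_ : pdiv 1 = 1%N) // INR_1 ln_1; split; first lra.
  suff : 0 <= \sum_(1 <= d < 2 | d %| 1) cofactor_bound 1 (1 %/ d) by lra.
  by apply: Rsum_ge0 => *; exact: cofactor_bound_ge0.
have h := @ln_aliquot_ratio N.+2 isT.
have -> : log_ratio_sum N.+2 = log_ratio_sum N.+1 + ln (INR (aliquot N.+2) / INR N.+2) by [].
set L := log_ratio_sum N.+1 in IH *.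
rewrite [in X in _ <= X <= _](big_nat_recr N.+2 1) // [in X in _ <= _ <= X](big_nat_recr N.+2 1) //=.
by move: IH h; lra.
Qed.

Lemma log_ratio_sum_asymp : exists (C : R) (N0 : nat), forall N, (N0 <= N)%coq_nat ->
  Rabs (log_ratio_sum N / INR N + exp (- euler_gamma) * ln (ln (INR N)))
    <= C * Rabs (ln (ln (ln (INR N)))).
Proof.
have [C1 [N0 [C1p h1]]] := log_pdiv_sum_asymp.
have [C2 [C2p h2]] := cofactor_sum.
exists (C1 + C2), (maxn 1 N0) => N /leP; rewrite geq_max => /andP[N1 /h1 [l3 h]].
have NR := INR_pos N1; have [b1 b2] := log_ratio_sum_bounds N; have b3 := h2 N.
rewrite (Rabs_pos_eq (ln _)); last lra.
set l := ln (ln (ln (INR N))) in l3 h *; set g := exp _ * _ in h *.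
apply: (Rmult_le_reg_l (INR N)) => //.
rewrite -{1}(Rabs_pos_eq (INR N)) -?Rabs_mult; last lra.
have -> : INR N * (log_ratio_sum N / INR N + g) =
  (log_ratio_sum N + log_pdiv_sum N) - (log_pdiv_sum N - INR N * g).
  by field; lra.
(* Passing from s(n)/n to the least prime factor costs O(1) on average, absorbed because ln ln ln N
   >= 1 beyond the threshold. *)
have c : C2 * INR N <= C2 * INR N * l.
  by have := Rmult_le_compat_l (C2 * INR N) _ _ (Rmult_le_pos _ _ C2p (Rlt_le _ _ NR)) l3; lra.
by move: h; split_Rabs; lra.
Qed.

End AliquotMean.

Theorem theorem3p2 :
  exists (C : R) (N0 : nat),
    forall N : nat, (N0 <= N)%nat ->
      Rabs (log_ratio_sum N / INR N + exp (- euler_gamma) * ln (ln (INR N)))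
        <= C * Rabs (ln (ln (ln (INR N)))).
Proof. exact AliquotMean.log_ratio_sum_asymp. Qed.
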